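(* Let $G$ be an $\omega$-categorical $3$-Engel $5$-group. Then $G$ is nilpotent.
   Context: A group $G$ is $\omega$-categorical if its first-order theory has a unique countable model up to isomorphism (finite groups are allowed); by the Ryll-Nardzewski theorem, for countable $G$ this is equivalent to: for every $n\in\mathbb{N}$ the componentwise action of $\mathrm{Aut}(G)$ on $G^n$ has only finitely many orbits, and the latter may be taken as the definition. A group is $3$-Engel if $[x,y,y,y]=1$ for all $x,y$, with left-normed commutators ($[x,y,z]=[[x,y],z]$, $[g,h]=g^{-1}h^{-1}gh$). A $5$-group is a group in which every element has order a power of $5$. *)

(* Defs.v *)
From mathcomp Require Import all_boot.
From mathcomp Require Import boolp classical_sets functions cardinality.

Set Implicit Arguments.
Unset Strict Implicit.
Unset Printing Implicit Defensive.

Local Open Scope classical_set_scope.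
Local Open Scope group_scope.

(* Groups are [groupType]s, which may be infinite; there
   [~ x, y] = x^-1 * y^-1 * x * y and [~ x, y, z] = [~ [~ x, y], z]. *)

Definition is_automorphism (G : groupType) (f : G -> G) : Prop :=
  bijective f /\ {morph f : x y / x * y}.

Definition aut_orbit (G : groupType) (n : nat) (t : n.-tuple G) :
    set (n.-tuple G) :=
  [set map_tuple f t | f in @is_automorphism G].

(* Omega-categoricity in its Ryll-Nardzewski form, taken as the definition;
   no cardinality restriction is put on G. *)
Definition omega_categorical (G : groupType) : Prop :=
  forall n : nat, finite_set (range (@aut_orbit G n)).

Definition three_engel (G : groupType) : Prop :=
  forall x y : G, [~ x, y, y, y] = 1.

Definition has_order (G : groupType) (x : G) (n : nat) : Prop :=
  [/\ 0 < n, x ^+ n = 1 & forall m : nat, 0 < m -> x ^+ m = 1 -> n <= m].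

Definition is_pgroup (p : nat) (G : groupType) : Prop :=
  forall x : G, exists k : nat, has_order x (p ^ k)%N.

Definition is_subgroup (G : groupType) (H : set G) : Prop :=
  H 1 /\ forall x y : G, H x -> H y -> H (x / y).

(* Indexed from 0: [lower_central G n] is the term usually written
   gamma_(n+1)(G). *)
Fixpoint lower_central (G : groupType) (n : nat) : set G :=
  if n is m.+1 then
    smallest (@is_subgroup G)
      [set [~ x, y] | x in @lower_central G m & y in setT]
  else setT.
Arguments lower_central : clear implicits.

Definition is_nilpotent (G : groupType) : Prop :=
  exists n : nat, lower_central G n = [set 1].

(* Main.v *)
Require Import Defs.
From HB Require Import structures.
From mathcomp Require Import all_boot all_algebra all_fingroup all_solvable.
From mathcomp Require Import boolp classical_sets functions cardinality.

(* Omega-categoricity makes finitely generated subgroups finite, hence nilpotent.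
   In a finite 3-Engel 5-group, polarising [x, y, y, y] = 1 on the normal closure
   V of an element g, modulo the next term of its central series, shows that V
   has class at most 2; so this holds in G.

   Let M = V / V'V^5, rho : G -> End(M) the action and q(x) = rho(x) + rho(x^-1) - 2.
   Since (rho(x) - 1)^3 = 0, the truncated logarithm A_x = (rho(x) - rho(x^-1)) / 2
   is exact and q(x) = A_x^2. The first-order variation of the Engel identity along
   V gives 3 A_y A_x A_y = 3 A_x A_y^2 + A_y^2 A_x, while (rho(xy) - 1)^3 = 0 gives
   A_x A_y^2 + A_y A_x A_y + A_y^2 A_x = 0. As 6 = 1 and 4 = -1 modulo 5, each
   q(y) is central; moreover q(y)^2 = 0.

   If arbitrarily long products of q's were nonzero, choose a nonzero
   q(v) q(k_0) ... q(k_n) q(l_0) ... q(l_n). The operators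
   a = q(v) sum_j q(k_j) q(l_j) and b = q(v) sum_j q(k_(j+1)) q(l_j) have the form
   (rho(v) - 1)(rho(c) - 1) with c in G, so the relation m' b = m a on M is
   definable from finitely many elements of G; it admits chains of maximal length
   exactly n, for every n, which contradicts omega-categoricity. Hence products of
   N values of q vanish on M, uniformly in g. Modulo the q's, a product of three
   factors rho(x) - 1 vanishes, so G acts nilpotently on M, then on V / V' as the
   exponent is bounded, and on V' by bilinearity of the commutator: G is nilpotent. *)

Set Implicit Arguments.
Unset Strict Implicit.
Unset Printing Implicit Defensive.

Import GRing.Theory.

Local Open Scope classical_set_scope.
Local Open Scope group_scope.
Local Open Scope ring_scope.

(** * Identities in non-commutative polynomials modulo 5 *)

Inductive nc : Type :=
  | NVar of nat | NConst of nat | NAdd of nc & nc | NMul of nc & nc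
  | NOpp of nc | NPow of nc & nat.

Section NcNormalForm.
Variable big : pred (seq nat).

Definition ncpol := seq (nat * seq nat).

Fixpoint ncins (t : nat * seq nat) (p : ncpol) : ncpol :=
  if p is u :: p' then
    if t.2 == u.2 then ((t.1 + u.1) %% 5, u.2)%N :: p' else u :: ncins t p'
  else [:: t].

Definition ncadd (p q : ncpol) : ncpol := foldr ncins q p.

(** Words satisfying [big] evaluate to zero by assumption. Dropping them at every product keeps
    normal forms short and proves identities that hold only modulo these words. *)
Definition ncterm (t u : nat * seq nat) (p : ncpol) : ncpol :=
  if big (t.2 ++ u.2) then p else ncins ((t.1 * u.1) %% 5, t.2 ++ u.2)%N p.

Definition ncmul (p q : ncpol) : ncpol :=
  foldr (fun t r => foldr (ncterm t) r q) [::] p.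

Arguments ncmul : simpl never.

(** Coefficients are kept modulo 5, so the sign of [NOpp] is multiplication by 4. *)
Fixpoint ncnf (e : nc) : ncpol :=
  match e with
  | NVar i => [:: (1, [:: i])%N]
  | NConst n => [:: (n %% 5, [::])%N]
  | NAdd e1 e2 => ncadd (ncnf e1) (ncnf e2)
  | NMul e1 e2 => ncmul (ncnf e1) (ncnf e2)
  | NOpp e1 => ncmul [:: (4, [::])%N] (ncnf e1)
  | NPow e1 n => iter n (ncmul (ncnf e1)) [:: (1, [::])%N]
  end.

Definition ncnull (e : nc) := all (fun t => t.1 %% 5 == 0)%N (ncnf e).

Variables (R : pzRingType) (R5 : 5%:R = 0 :> R) (env : nat -> R).
Hypothesis big0 : forall w, big w -> \prod_(i <- w) env i = 0.

Fixpoint nceval (e : nc) : R :=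
  match e with
  | NVar i => env i
  | NConst n => n%:R
  | NAdd e1 e2 => nceval e1 + nceval e2
  | NMul e1 e2 => nceval e1 * nceval e2
  | NOpp e1 => - nceval e1
  | NPow e1 n => nceval e1 ^+ n
  end.

Definition ncpeval (p : ncpol) : R :=
  \sum_(t <- p) t.1%:R * \prod_(i <- t.2) env i.

Lemma natr_mod5 n : (n %% 5)%:R = n%:R :> R.
Proof. by rewrite [in RHS](divn_eq n 5) natrD natrM R5 mulr0 add0r. Qed.

Lemma ncpeval_ins t p :
  ncpeval (ncins t p) = t.1%:R * \prod_(i <- t.2) env i + ncpeval p.
Proof.
rewrite /ncpeval; elim: p => [|u p IHp] /=; first by rewrite big_seq1 big_nil addr0.
case: eqP => [eq_tu|_]; rewrite !big_cons /=.
  by rewrite natr_mod5 natrD mulrDl eq_tu addrA.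
by rewrite IHp addrCA.
Qed.

Lemma ncpeval_add p q : ncpeval (ncadd p q) = ncpeval p + ncpeval q.
Proof.
elim: p => [|t p IHp] /=; first by rewrite {2}/ncpeval big_nil add0r.
by rewrite ncpeval_ins IHp {3}/ncpeval big_cons addrA.
Qed.

Lemma ncpeval_terms t q r :
  ncpeval (foldr (ncterm t) r q) =
  t.1%:R * \prod_(i <- t.2) env i * ncpeval q + ncpeval r.
Proof.
rewrite {2}/ncpeval mulr_sumr.
elim: q => [|u q IHq] /=; first by rewrite big_nil add0r.
rewrite big_cons -addrA -IHq /ncterm.
set x := _ * (u.1%:R * _).
have -> : x = (t.1 * u.1)%:R * \prod_(i <- t.2 ++ u.2) env i.
  by rewrite big_cat /= natrM /x -!mulrA; congr (_ * _); rewrite !mulrA commr_nat.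
case: ifP => [/big0-> |_]; first by rewrite mulr0 add0r.
by rewrite ncpeval_ins natr_mod5.
Qed.

Lemma ncpeval_mul p q : ncpeval (ncmul p q) = ncpeval p * ncpeval q.
Proof.
rewrite {2}/ncpeval mulr_suml; elim: p => [|t p IHp].
  by rewrite /ncpeval !big_nil.
by rewrite /ncmul /= ncpeval_terms big_cons -IHp.
Qed.

Lemma ncpeval_nf e : ncpeval (ncnf e) = nceval e.
Proof.
elim: e => [i|n|e1 IH1 e2 IH2|e1 IH1 e2 IH2|e IH|e IH n] /=.
- by rewrite /ncpeval !big_seq1 mul1r.
- by rewrite /ncpeval big_seq1 big_nil mulr1 natr_mod5.
- by rewrite ncpeval_add IH1 IH2.
- by rewrite ncpeval_mul IH1 IH2.
- rewrite ncpeval_mul IH {1}/ncpeval big_seq1 big_nil mulr1.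
  by apply/eqP; rewrite -addr_eq0 -[X in _ + X]mul1r -mulrDl natr1 R5 mul0r.
- elim: n => [|n IHn]; first by rewrite /ncpeval big_seq1 big_nil mulr1.
  by rewrite iterS ncpeval_mul IHn IH exprS.
Qed.

Lemma ncnullP e : ncnull e -> nceval e = 0.
Proof.
move=> /allP null_e; rewrite -ncpeval_nf /ncpeval big_seq big1 // => t /null_e.
by rewrite -natr_mod5 => /eqP ->; rewrite mul0r.
Qed.

End NcNormalForm.

Ltac ncindex t vs :=
  match vs with
  | t :: _ => constr:(0%N)
  | _ :: ?vs' => let n := ncindex t vs' in constr:(S n)
  end.

Ltac ncreify vs t :=
  match t with
  | @GRing.zero _ => constr:(NConst 0)
  | GRing.one _ => constr:(NConst 1)
  | GRing.natmul (GRing.one _) ?n => constr:(NConst n)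
  | GRing.add ?a ?b =>
      let a' := ncreify vs a in let b' := ncreify vs b in constr:(NAdd a' b')
  | GRing.mul ?a ?b =>
      let a' := ncreify vs a in let b' := ncreify vs b in constr:(NMul a' b')
  | GRing.opp ?a => let a' := ncreify vs a in constr:(NOpp a')
  | GRing.exp ?a ?n => let a' := ncreify vs a in constr:(NPow a' n)
  | _ => let i := ncindex t vs in constr:(NVar i)
  end.

(* [nc_ring R5 vs big0] proves an identity of non-commutative polynomials modulo
   5 in the variables [vs], discarding the monomials that vanish by [big0]. *)
Ltac nc_ring R5 vs big0 :=
  apply/subr0_eq;
  match goal with |- ?t = 0 =>
    let e := ncreify vs t in
    exact: (ncnullP R5 (env := nth 0 vs) big0 (e := e) isT)
  end.

(** * Three-Engel actions in characteristic 5 *)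

Section Subgroups.
Variable G : groupType.
Local Open Scope group_scope.
Implicit Types (A H : set G) (x y g : G).

Lemma subgroup1 H : is_subgroup H -> H 1. Proof. by case. Qed.

Lemma subgroupV H x : is_subgroup H -> H x -> H x^-1.
Proof. by case=> H1 HB Hx; rewrite -div1g; apply: HB. Qed.

Lemma subgroupM H x y : is_subgroup H -> H x -> H y -> H (x * y).
Proof.
by move=> sH Hx Hy; rewrite -[y]invgK; apply: sH.2 => //; apply: subgroupV.
Qed.

Lemma subgroup_smallest A : is_subgroup (smallest (@is_subgroup G) A).
Proof.
split=> [H [sH _]|x y Ax Ay H sH]; first exact: subgroup1.
by apply: sH.1.2; [apply: Ax | apply: Ay].
Qed.

Lemma smallest_conj A :
    (forall x y, A x -> A (x ^ y)) ->
  forall x y, smallest (@is_subgroup G) A x -> smallest (@is_subgroup G) A (x ^ y).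
Proof.
move=> AJ x y; have [s1 sB] := subgroup_smallest A.
apply: (smallest_sub (X := [set x | smallest (@is_subgroup G) A (x ^ y)])).
  split=> [|u w /= Au Aw]; first by rewrite /= conj1g.
  by rewrite conjMg conjVg; apply: sB.
by move=> u /(AJ _ y) Au H [_]; apply.
Qed.

Definition normal_closure g : set G := smallest (@is_subgroup G) (range (conjg g)).

Lemma ncl_subgroup g : is_subgroup (normal_closure g).
Proof. exact: subgroup_smallest. Qed.

Lemma ncl_conj g x y : normal_closure g x -> normal_closure g (x ^ y).
Proof.
apply: smallest_conj => {}x {}y [z _ <-]; exists (z * y) => //.
exact: conjgM.
Qed.

Lemma ncl_id g : normal_closure g g.
Proof. by apply: sub_gen_smallest; exists 1 => //; rewrite conjg1. Qed.

Lemma ncl_comm g x y : normal_closure g x -> normal_closure g [~ x, y].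
Proof.
move=> gx; apply: subgroupM (ncl_subgroup g) _ (ncl_conj _ gx).
exact: subgroupV (ncl_subgroup g) gx.
Qed.

Lemma ncl_commr g x y : normal_closure g x -> normal_closure g [~ y, x].
Proof.
by move=> gx; rewrite -invgR; apply: subgroupV (ncl_subgroup g) _; apply: ncl_comm.
Qed.

End Subgroups.

(** * Multiplicative maps from a group to a ring of characteristic 5 *)

Section ThreeEngelRing.
Variables (G : groupType) (R : pzRingType) (rho : G -> R).
Hypotheses (R5 : 5%:R = 0 :> R) (rho1 : rho 1%g = 1).
Hypothesis rhoM : forall x y, rho (x * y)%g = rho x * rho y.

Definition d x : R := rho x - 1.

(** Reflects that the normal closure of [v] has class at most 2: in an action by conjugation, [d u]
    is commutation with [u]. *)
Hypothesis d_ncl3 : forall v u1 u2 u3, normal_closure v u1 ->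
  normal_closure v u2 -> normal_closure v u3 -> d u1 * d u2 * d u3 = 0.

(* The Fox derivative with respect to [y] of the identity
   [y * y ^ (y ^ x) = y ^ (y ^ x) * y]. *)
Hypothesis fox_engel : forall x y, let c := rho (y ^ x)%g in
  let c' := rho (y ^ x)^-1%g in
  c' * rho y * c - rho x * c' * rho y * c + c + rho x
  + rho x * c' * rho y * c * rho y - c * rho y - rho x * rho y - 1 = 0.

Lemma rhoV x : rho x * rho x^-1%g = 1.
Proof. by rewrite -rhoM mulgV rho1. Qed.

Lemma rhoVl x : rho x^-1%g * rho x = 1.
Proof. by rewrite -rhoM mulVg rho1. Qed.

(** The image of the integral group ring; rules for moving [rho x] past a factor extend to it by
    induction. *)
Inductive rho_span : R -> Prop :=
  | SpanRho x : rho_span (rho x)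
  | SpanAdd a b : rho_span a -> rho_span b -> rho_span (a + b)
  | SpanOpp a : rho_span a -> rho_span (- a).

Lemma span1 : rho_span 1.
Proof. by rewrite -rho1; apply: SpanRho. Qed.

Lemma spanM a b : rho_span a -> rho_span b -> rho_span (a * b).
Proof.
move=> Sa Sb; elim: Sa => [x|a1 a2 _ S1 _ S2|a1 _ S1].
- elim: Sb => [y|b1 b2 _ S1 _ S2|b1 _ S1].
  + by rewrite -rhoM; apply: SpanRho.
  + by rewrite mulrDr; apply: SpanAdd.
  + by rewrite mulrN; apply: SpanOpp.
- by rewrite mulrDl; apply: SpanAdd.
- by rewrite mulNr; apply: SpanOpp.
Qed.

Lemma span_nat n : rho_span n%:R.
Proof.
elim: n => [|n IHn]; last by rewrite -natr1; apply: SpanAdd IHn span1.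
by rewrite mulr0n -[0](subrr 1); apply: SpanAdd (SpanOpp _); apply: span1.
Qed.

Lemma d_span x : rho_span (d x).
Proof. exact: SpanAdd (SpanRho x) (SpanOpp span1). Qed.

Lemma rho_conj x u : rho x * d u = d (u ^ x^-1)%g * rho x.
Proof.
rewrite /d mulrBr mulrBl mulr1 mul1r -!rhoM; congr (rho _ - _).
by rewrite conjgE invgK !mulgA mulgVK.
Qed.

(** By [rho_conj], a factor [rho x] moves right past [d u] at the price of conjugating [u], which
    stays in the normal closure of [v]. The three factors [d] then become adjacent. *)
Lemma d_span3 v u1 u2 u3 a b :
    normal_closure v u1 -> normal_closure v u2 -> normal_closure v u3 ->
    rho_span a -> rho_span b ->
  d u1 * a * d u2 * b * d u3 = 0.
Proof.
move=> v1 v2 v3 Sa Sb; elim: Sa u2 v2 => [x|a1 a2 _ S1 _ S2|a1 _ S1] u2 v2.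
- rewrite -(mulrA (d u1)) rho_conj -!mulrA.
  elim: Sb u3 v3 => [y|b1 b2 _ S1 _ S2|b1 _ S1] u3 v3.
  + rewrite rho_conj (mulrA (rho x)) rho_conj !mulrA.
    by rewrite (d_ncl3 (v := v)) ?mul0r //; do ?apply: ncl_conj.
  + by rewrite (mulrDl b1) !(mulrDr _ (_ * _) (_ * _)) S1 ?S2 ?addr0.
  + by rewrite !(mulNr, mulrN) S1 ?oppr0.
- by rewrite (mulrDr _ a1) !(mulrDl (_ * _) (_ * _)) S1 ?S2 ?addr0.
- by rewrite !(mulNr, mulrN) S1 ?oppr0.
Qed.

(* The truncated logarithm of [rho x], as (rho x - 1)^3 = 0 and -1/2 = 2. *)
Definition lg x : R := d x * (1 + 2 * d x).

Lemma lg_span x : rho_span (lg x).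
Proof.
apply: spanM (d_span x) (SpanAdd span1 (spanM (span_nat 2) (d_span x))).
Qed.

Lemma lg_span3 v u1 u2 u3 a b :
    normal_closure v u1 -> normal_closure v u2 -> normal_closure v u3 ->
    rho_span a -> rho_span b ->
  lg u1 * a * lg u2 * b * lg u3 = 0.
Proof.
move=> v1 v2 v3 Sa Sb; pose e u := 1 + 2 * d u.
have Se u : rho_span (e u).
  exact: SpanAdd span1 (spanM (span_nat 2) (d_span u)).
have -> : lg u1 * a * lg u2 * b * lg u3 =
    d u1 * (e u1 * a) * d u2 * (e u2 * b) * d u3 * e u3 by rewrite !mulrA.
by rewrite (d_span3 v1 v2 v3) ?mul0r //; apply: spanM.
Qed.

(** Supplies the vanishing words for [nc_ring]: any three letters selected by [T] annihilate each
    other, whatever stands between them. *)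
Lemma word_null (T : pred nat) (env : nat -> R) :
    (forall i, rho_span (env i)) ->
    (forall i j k a b, T i -> T j -> T k -> rho_span a -> rho_span b ->
       env i * a * env j * b * env k = 0) ->
  forall w, (2 < count T w)%N -> \prod_(i <- w) env i = 0.
Proof.
move=> Senv T0 w.
(* A prefix of value [r] with [n] letters from [T] is annihilated by [3 - n] further ones. For
   [n = 0] this is the hypothesis itself, so nothing is recorded. *)
pose N n r := match n with
  | 0 => True
  | 1 => forall j k a b, T j -> T k -> rho_span a -> rho_span b ->
           r * a * env j * b * env k = 0
  | 2 => forall k a, T k -> rho_span a -> r * a * env k = 0
  | _ => r = 0
  end.
suff: N (count T w) (\prod_(i <- w) env i).
  by case: (count T w) => [|[|[|n]]].
elim/last_ind: w => [|w i IHw]; first by [].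
rewrite -cats1 count_cat big_cat big_seq1 /= addn0.
move: (\prod_(_ <- _) _) (count T w) IHw => r n Nr.
case Ti: (T i).
  case: n Nr => [|[|[|n]]] /= Nr.
  - by move=> j k a b Tj Tk Sa Sb; rewrite -!mulrA !mulrA -!(mulrA r) T0 ?mulr0.
  - by move=> k a Tk Sa; rewrite -[r]mulr1 (Nr _ _ 1 a) //; apply: span1.
  - by rewrite -[r]mulr1 Nr //; apply: span1.
  - by rewrite Nr mul0r.
rewrite addn0; case: n Nr => [|[|[|n]]] //= Nr.
- by move=> j k a b Tj Tk Sa Sb; rewrite -(mulrA r) Nr //; apply: spanM.
- by move=> k a Tk Sa; rewrite -(mulrA r) Nr //; apply: spanM.
- by rewrite Nr mul0r.
Qed.

Lemma d_word x w : (2 < size w)%N -> \prod_(i <- w) [:: d x]`_i = 0.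
Proof.
rewrite -count_predT; apply: word_null => [[|i]|[|i] [|j] [|k] a b _ _ _ Sa Sb] /=;
  rewrite ?nth_nil ?mulr0 ?mul0r ?(d_span3 (v := x)) //; try exact: ncl_id.
- exact: d_span.
- exact: span_nat 0%N.
Qed.

(** The truncated exponential of [lg x], with 3 for 1/2. *)
Lemma rho_lg x : rho x = 1 + lg x + 3 * lg x ^+ 2.
Proof.
transitivity (1 + d x); first by rewrite addrC subrK.
rewrite /lg; move: (d x) (@d_word x) => e ew; nc_ring R5 [:: e] ew.
Qed.

Lemma rhoV_lg x : rho x^-1%g = 1 - lg x + 3 * lg x ^+ 2.
Proof.
transitivity (1 - d x + d x ^+ 2); last first.
  rewrite /lg; move: (d x) (@d_word x) => e ew; nc_ring R5 [:: e] ew.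
have e3: d x ^+ 3 = 0 by rewrite !exprS mulr1 mulrA (d_ncl3 (v := x)) //;
  exact: ncl_id.
have dx : rho x = 1 + d x by rewrite addrC subrK.
have e1 : rho x * (1 - d x + d x ^+ 2) = 1.
  rewrite dx -[RHS]addr0 -e3; move: (d x) (@d_word x) => e ew.
  nc_ring R5 [:: e] ew.
by rewrite -[LHS]mulr1 -[X in _ * X]e1 mulrA rhoVl mul1r.
Qed.

(** Letters 0 and 1 stand for [lg x] and [lg y]; three equal ones annihilate a word. *)
Definition lg_big (w : seq nat) := (2 < count_mem 0 w)%N || (2 < count_mem 1 w)%N.

Lemma lg_word x y w : lg_big w -> \prod_(i <- w) [:: lg x; lg y]`_i = 0.
Proof.
have Senv i : rho_span [:: lg x; lg y]`_i.
  by case: i => [|[|i]] /=; rewrite ?nth_nil;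
    [exact: lg_span | exact: lg_span | exact: span_nat 0%N].
case/orP; apply: word_null => // i j k a b /eqP-> /eqP-> /eqP-> Sa Sb /=.
  by rewrite (lg_span3 (v := x)) //; exact: ncl_id.
by rewrite (lg_span3 (v := y)) //; exact: ncl_id.
Qed.

Lemma lg_conj x y : lg (y ^ x)%g = rho x^-1%g * lg y * rho x.
Proof.
have dJ : d (y ^ x)%g = rho x^-1%g * d y * rho x.
  by rewrite /d mulrBr mulrBl mulr1 rhoVl -!rhoM conjgE mulgA.
rewrite /lg dJ; move: (d y) => e.
rewrite mulrDr mulr1 (mulrDr e) mulr1 (mulrDr (rho _)) mulrDl; congr (_ + _).
rewrite !mulr_natl !mulrnAr mulrnAl; congr (_ *+ _).
by rewrite -!mulrA (mulrA (rho x)) rhoV mul1r.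
Qed.

(** Write the Fox identity in exponentials of [lg y] and of its conjugate [C = lg (y ^ x)]. Both
    come from the normal closure of [y], so only words of degree at most 2 in them survive. *)
Lemma engel_lg x y : let C := rho x^-1%g * lg y * rho x in
  lg y * C - 2 * C * lg y + rho x * lg y ^+ 2 = 0.
Proof.
rewrite -lg_conj /= -(fox_engel x y) /= (rhoV_lg (y ^ x)%g) (rho_lg (y ^ x)%g) (rho_lg y).
have Tw w : (2 < count (leq 1) w)%N ->
    \prod_(i <- w) [:: rho x; lg y; lg (y ^ x)%g]`_i = 0.
  have ncl i : (0 < i)%N -> exists2 u, normal_closure y u &
      [:: rho x; lg y; lg (y ^ x)%g]`_i = lg u \/ [:: rho x; lg y;
        lg (y ^ x)%g]`_i = 0.
    case: i => [|[|[|i]]] //= _; last by exists y; rewrite ?nth_nil;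
      [exact: ncl_id|right].
      by exists y; [exact: ncl_id|left].
    by exists (y ^ x)%g; [apply: ncl_conj; exact: ncl_id|left].
  apply: word_null => [[|[|[|i]]] /=|i j k a b].
  - exact: SpanRho.
  - exact: lg_span.
  - exact: lg_span.
  - rewrite nth_nil; exact: span_nat 0%N.
  - move=> /ncl[u1 v1 E1] /ncl[u2 v2 E2] /ncl[u3 v3 E3] Sa Sb.
    case: E1 => ->; rewrite ?mul0r //; case: E2 => ->; rewrite ?mulr0 ?mul0r //.
    by case: E3 => ->; rewrite ?mulr0 // (lg_span3 v1 v2 v3).
move: (lg y) (lg (y ^ x)%g) (rho x) Tw => B C e Tw.
nc_ring R5 [:: e; B; C] Tw.
Qed.

Lemma rho_cube x y : (rho x * rho y - 1) ^+ 3 = 0.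
Proof.
rewrite -rhoM -/(d _) !exprS mulr1 mulrA (d_ncl3 (v := (x * y)%g)) //;
  exact: ncl_id.
Qed.

(* In characteristic 5 the linearised identities [x,y,y,y] = 1 and
   [(rho (x y) - 1)^3 = 0] have a common consequence free of [lg y * lg x * lg y]. *)
Lemma lgC2 x y : lg x * lg y ^+ 2 = lg y ^+ 2 * lg x.
Proof.
have E1 := engel_lg x y; have E2 := engel_lg x^-1%g y; rewrite invgK /= in E1 E2.
have C1 := rho_cube x y; have C2 := rho_cube x y^-1%g.
have C3 := rho_cube x^-1%g y; have C4 := rho_cube x^-1%g y^-1%g.
(* The zeros are replaced in turn by [E2], [E1], [C1], [C2], [C3], [C4]. The signs extract the part
   odd in [lg x] and, in the cubes, even in [lg y]; only words of degree 1 in [lg x] and 2 in [lg y]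
   remain. *)
apply/subr0_eq; transitivity (2 * (0 - 0 + 0 + 0 - 0 - 0) : R); last first.
  by rewrite !(subr0, addr0) mulr0.
rewrite -{1}E2 -{1}E1 -{1}C1 -{1}C2 -{1}C3 -{1}C4 !rhoV_lg !rho_lg.
move: (lg x) (lg y) (@lg_word x y) => A B ABw.
nc_ring R5 [:: A; B] ABw.
Qed.

(** With [A = lg x] and [B = lg y], the part of [engel_lg] linear in [A] reads
    [3 BAB = 3 AB^2 + B^2A]. By [lgC2] the right side is [4 B^2A], and 4/3 = 3 modulo 5. *)
Lemma lg_sandwich x y : lg y * lg x * lg y = 3 * lg y ^+ 2 * lg x.
Proof.
have E1 := engel_lg x y; have E2 := engel_lg x^-1%g y; rewrite invgK /= in E1 E2.
apply/subr0_eq; transitivity (0 - 0 + (lg x * lg y ^+ 2 - lg y ^+ 2 * lg x));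
  last first.
  by rewrite lgC2 !subrr addr0.
rewrite -{1}E2 -{1}E1 !rhoV_lg !rho_lg.
move: (lg x) (lg y) (@lg_word x y) => A B ABw.
nc_ring R5 [:: A; B] ABw.
Qed.

Definition q x : R := rho x + rho x^-1%g - 2.

Lemma q_lg x : q x = lg x ^+ 2.
Proof.
rewrite /q rhoV_lg rho_lg; move: (lg x) (@lg_word x x) => A Aw.
nc_ring R5 [:: A; A] Aw.
Qed.

Lemma q_span x : rho_span (q x).
Proof. by rewrite q_lg expr2; apply: spanM; apply: lg_span. Qed.

Lemma q_rhoC x y : q y * rho x = rho x * q y.
Proof.
have C2 : GRing.comm (q y) (lg x) by rewrite /GRing.comm q_lg lgC2.
rewrite rho_lg; apply: commrD; first exact: commrD (commr1 _) C2.
by apply: commrM; [apply: commr_nat | apply: commrX].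
Qed.

Lemma q_spanC x a : rho_span a -> q x * a = a * q x.
Proof.
elim=> [y|b c _ IHb _ IHc|b _ IHb]; first exact: q_rhoC.
  by rewrite (mulrDr _ b) (mulrDl b) IHb IHc.
by rewrite mulrN mulNr IHb.
Qed.

Lemma d_lg x : d x = lg x + 3 * lg x ^+ 2.
Proof. by rewrite /d rho_lg -[1 + _ + _]addrA [1 + _]addrC addrK. Qed.

Lemma d_q x : d x * q x = 0.
Proof.
transitivity ((lg x + 3 * lg x ^+ 2) * lg x ^+ 2).
  by rewrite d_lg q_lg.
move: (lg x) (@lg_word x x) => A Aw; nc_ring R5 [:: A; A] Aw.
Qed.

Lemma d_sq x : d x * d x = q x.
Proof.
rewrite q_lg d_lg; move: (lg x) (@lg_word x x) => A Aw.
nc_ring R5 [:: A; A] Aw.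
Qed.

Lemma q_sq x : q x * q x = 0.
Proof. by rewrite -{1}d_sq -mulrA d_q mulr0. Qed.

(** In [d (u * w) = d u * d w + d u + d w] the quadratic term is killed by [d v], so
    [u -> d v * d u] turns products into sums. *)
Lemma d_nclM v u w : normal_closure v u -> normal_closure v w ->
  d v * d (u * w)%g = d v * d u + d v * d w.
Proof.
move=> vu vw; have -> : d (u * w)%g = d u * d w + (d u + d w).
  rewrite /d rhoM; move: (rho u) (rho w) => a b.
  have ab0 w' : pred0 w' -> \prod_(i <- w') [:: a; b]`_i = 0 by [].
  nc_ring R5 [:: a; b] ab0.
by rewrite (mulrDr _ (d u * _)) mulrA (d_ncl3 (v :=
  v)) ?add0r ?(mulrDr _ (d u)) //; exact: ncl_id.
Qed.

Lemma d_nclV v u : normal_closure v u -> d v * d u^-1%g = - (d v * d u).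
Proof.
move=> vu; apply/eqP; rewrite -addr_eq0 -d_nclM //.
  by rewrite mulVg /d rho1 subrr mulr0.
exact: subgroupV (ncl_subgroup v) vu.
Qed.

Lemma d_conj x u : d (u ^ x)%g = rho x^-1%g * d u * rho x.
Proof. by rewrite /d mulrBr mulrBl mulr1 rhoVl -!rhoM conjgE mulgA. Qed.

(* On elements of a normal closure of class 2, this acts as [q x] does. *)
Definition qact (m x : G) : G := (m ^ x * m ^ x^-1 * m^-1 * m^-1)%g.

Lemma qact_ncl v m x : normal_closure v m -> normal_closure v (qact m x).
Proof.
have sv := ncl_subgroup v; move=> vm.
by do 2![apply: sv.2 => //]; apply: subgroupM sv _ _; apply: ncl_conj.
Qed.

(** With [A = lg x] and [M = lg m], additivity makes the left side [lg v] times
    [3 AMA + A^2M + MA^2], which [lgC2] and [lg_sandwich] turn into [11 A^2M = A^2M]. *)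
Lemma d_qact v m x : normal_closure v m ->
  d v * d (qact m x) = q x * (d v * d m).
Proof.
move=> vm; have sv := ncl_subgroup v; have vM u w := @subgroupM _ _ u w sv.
have vV : normal_closure v m^-1%g by exact: subgroupV sv vm.
have vJ y : normal_closure v (m ^ y)%g by apply: ncl_conj.
have vJ2 := vM _ _ (vJ x) (vJ x^-1%g).
rewrite /qact (d_nclM (vM _ _ vJ2 vV) vV) (d_nclM vJ2 vV).
rewrite (d_nclM (vJ x) (vJ x^-1%g)) !(d_nclV vm).
rewrite !d_conj invgK q_lg.
(* Three letters [lg x], or three letters among [lg m] and [lg v], annihilate a word. *)
have Tw w : (2 < count_mem 0 w)%N || (2 < count (leq 1) w)%N ->
    \prod_(i <- w) [:: lg x; lg m; lg v]`_i = 0.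
  have Senv i : rho_span [:: lg x; lg m; lg v]`_i.
    case: i => [|[|[|i]]] /=; rewrite ?nth_nil; try exact: lg_span.
    exact: span_nat 0%N.
  case/orP; apply: word_null => // i j k a b.
    by move=> /eqP-> /eqP-> /eqP-> Sa Sb /=; rewrite (lg_span3 (v := x)) //;
      exact: ncl_id.
  have ncl l : (0 < l)%N -> exists2 u, normal_closure v u &
      [:: lg x; lg m; lg v]`_l = lg u \/ [:: lg x; lg m; lg v]`_l = 0.
    case: l => [|[|[|l]]] //= _; first by exists m; [|left].
      by exists v; [exact: ncl_id|left].
    by exists v; rewrite ?nth_nil; [exact: ncl_id|right].
  move=> /ncl[u1 v1 E1] /ncl[u2 v2 E2] /ncl[u3 v3 E3] Sa Sb.
  case: E1 => ->; rewrite ?mul0r //; case: E2 => ->; rewrite ?mulr0 ?mul0r //.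
  by case: E3 => ->; rewrite ?mulr0 // (lg_span3 v1 v2 v3).
have C1 := lgC2 m x; have C2 := lgC2 v x; have C3 := lg_sandwich m x.
transitivity (lg v * (3 * (lg x * lg m * lg x) + lg x ^+ 2 * lg m + lg m * lg x ^+ 2)).
  rewrite !d_lg rhoV_lg rho_lg; move: (lg x) (lg m) (lg v) Tw => A B C Tw.
  nc_ring R5 [:: A; B; C] Tw.
rewrite C1 C3; transitivity (lg v * lg x ^+ 2 * lg m).
  move: (lg x) (lg m) (lg v) Tw => A B C Tw.
  nc_ring R5 [:: A; B; C] Tw.
rewrite C2 !d_lg; move: (lg x) (lg m) (lg v) Tw => A B C Tw.
nc_ring R5 [:: A; B; C] Tw.
Qed.

(** Comparing [q (x * y)] with [q x] and [q y] shows that [d x * d y + d y * d x] lies in the ideal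
    of the values of [q]. *)
Lemma q_null_anticomm r x y : (forall w, r * q w = 0) ->
  r * d x * d y = - (r * d y * d x).
Proof.
move=> r0; apply/eqP; rewrite -addr_eq0 -!(mulrA r) -mulrDr; apply/eqP.
have -> : d x * d y + d y * d x = q (x * y)%g + q x * (lg y - 1) + q y * (lg x - 1).
  transitivity (q (x * y)%g - lg x ^+ 2 - lg y ^+ 2 + lg y * lg x ^+ 2 + lg y ^+ 2 * lg x).
    rewrite !d_lg /q invgM !rhoM !rhoV_lg !rho_lg.
    move: (lg x) (lg y) (@lg_word x y) => A B ABw.
    nc_ring R5 [:: A; B] ABw.
  rewrite (lgC2 y) (q_lg x) (q_lg y); move: (q _) (lg x) (lg y) => e A B.
  have e0 w : pred0 w -> \prod_(i <- w) [:: e; A; B]`_i = 0 by [].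
  nc_ring R5 [:: e; A; B] e0.
by rewrite (mulrDr r (q _ + _)) (mulrDr r (q _)) !(mulrA r (q _)) !r0 !mul0r !addr0.
Qed.

Lemma q_null_span r a : (forall w, r * q w = 0) -> rho_span a ->
  forall w, r * a * q w = 0.
Proof. by move=> r0 Sa w; rewrite -mulrA -q_spanC // mulrA r0 mul0r. Qed.

(** After [r] the elements [d x] anticommute, so [d z] commutes with [d x * d y]. It also
    anticommutes with [d (x * y)], hence with [d x * d y], and twice the product is zero. *)
Lemma q_null_cube r x y z : (forall w, r * q w = 0) -> r * d x * d y * d z = 0.
Proof.
move=> r0; have rx := q_null_span r0 (d_span x).
have dM : d (x * y)%g = d x + d y + d x * d y.
  rewrite /d rhoM; move: (rho x) (rho y) => a b.
  have ab0 w' : pred0 w' -> \prod_(i <- w') [:: a; b]`_i = 0 by [].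
  nc_ring R5 [:: a; b] ab0.
have := (q_null_anticomm (x * y)%g z r0, q_null_anticomm x z r0).
have := (q_null_anticomm y z r0, q_null_anticomm y z rx).
rewrite dM; move: (d x) (d y) (d z) => X Y Z [H2 H3] [H H1].
(* The leading 3 is 1/2; the rest is a combination of anticommutators. *)
transitivity (3 * (r * (X + Y + X * Y) * Z + r * Z * (X + Y + X * Y)
    - (r * X * Z + r * Z * X) * (1 + Y) - (r * Y * Z + r * Z * Y)
    + (r * X * Y * Z + r * X * Z * Y))).
  have r1 w : pred0 w -> \prod_(i <- w) [:: r; X; Y; Z]`_i = 0 by [].
  nc_ring R5 [:: r; X; Y; Z] r1.
by rewrite H3 addNr H H1 H2 !addNr mul0r !(subr0, addr0) mulr0.
Qed.

(** Three factors [d] are absorbed into [r] at a time. They commute with the remaining [k] values of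
    [q], and [r] times those kills every [q], so [q_null_cube] applies. *)
Lemma d_nilpotent k r :
    (forall s, size s = k -> r * \prod_(x <- s) q x = 0) ->
  forall s, size s = (3 * k)%N -> r * \prod_(x <- s) d x = 0.
Proof.
elim: k r => [|k IHk] r r0 s.
  by move=> /eqP; rewrite muln0 size_eq0 => /eqP ->; have := r0 [::] erefl;
    rewrite !big_nil.
rewrite mulnS; case: s => [|x [|y [|z s]]] // [size_s].
rewrite !big_cons !mulrA; apply: IHk size_s => s' size_s'.
have Sq : rho_span (\prod_(w <- s') q w).
  elim: s' {size_s'} => [|w s' IHs']; first by rewrite big_nil; exact: span1.
  by rewrite big_cons; apply: spanM IHs'; apply: q_span.
suff C a : rho_span a -> \prod_(w <- s') q w * a = a * \prod_(w <- s') q w.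
  rewrite -!(mulrA r) -C; last by do 2?apply: spanM; apply: d_span.
  rewrite !mulrA; apply: q_null_cube => w; rewrite -mulrA.
  by have := r0 (rcons s' w);
    rewrite size_rcons size_s' -cats1 big_cat big_seq1 => ->.
move=> Sa; elim: s' {size_s' Sq} => [|w s' IHs'];
  first by rewrite big_nil mul1r mulr1.
by rewrite big_cons -mulrA IHs' !mulrA q_spanC.
Qed.

(** * Chains and dual chains built from products of values of [q] *)

Section Chain.
Variables (n : nat) (v : G) (k l : nat -> G).

Definition qprod (f : nat -> G) (s : seq nat) : R := \prod_(i <- s) q (f i).

Lemma qprod_span f s : rho_span (qprod f s).
Proof.
rewrite /qprod; elim: s => [|i s IHs]; first by rewrite big_nil; exact: span1.
by rewrite big_cons; apply: spanM IHs; apply: q_span.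
Qed.

Lemma qprod_rem f s i : i \in s -> q (f i) * qprod f (rem i s) = qprod f s.
Proof.
rewrite /qprod; elim: s => [//|j s IHs] /=; rewrite inE eq_sym.
case: eqP => [-> _|_ /= i_s]; first by rewrite big_cons.
by rewrite !big_cons mulrA (q_spanC _ (q_span _)) -mulrA IHs.
Qed.

Lemma qprod_null f s i : i \in s -> q (f i) * qprod f s = 0.
Proof. by move=> i_s; rewrite -(qprod_rem f i_s) mulrA q_sq mul0r. Qed.

Definition qact2 i j := qact (qact v (k i)) (l j).
(** Since [u -> d v * d u] is additive on the normal closure of [v], products of group elements
    realise the two sums of [aE] and [bE]. *)
Definition alpha := (\prod_(0 <= i < n.+1) qact2 i i)%g.
Definition beta := (\prod_(0 <= i < n) qact2 i.+1 i)%g.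

Let N := index_iota 0 n.+1.
Let a := d v * d alpha.
Let b := d v * d beta.
(** Omitting one factor singles out one summand: squares of [q] vanish, so [x i] annihilates
    [q (k j)], and [t i] annihilates [q (l j)], for all [j <= n] other than [i]. *)
Let x i := qprod k (rem i N).
Let t i := qprod l (rem i N).

Lemma d_nclprod (I : Type) (s : seq I) (u : I -> G) :
    (forall i, normal_closure v (u i)) ->
  d v * d (\prod_(i <- s) u i)%g = \sum_(i <- s) d v * d (u i).
Proof.
move=> vu; have vs s' : normal_closure v (\prod_(i <- s') u i)%g.
  apply: big_ind => //; first exact: subgroup1 (ncl_subgroup v).
  by move=> *; apply: subgroupM (ncl_subgroup v) _ _.
elim: s => [|i s IHs]; first by rewrite !big_nil /d rho1 subrr mulr0.
by rewrite !big_cons d_nclM // IHs.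
Qed.

Lemma d_qact2 i j : d v * d (qact2 i j) = q (l j) * q (k i) * q v.
Proof.
by rewrite !d_qact ?mulrA -?mulrA ?d_sq //; do ?apply: qact_ncl; exact: ncl_id.
Qed.

Lemma qact2_ncl i j : normal_closure v (qact2 i j).
Proof. by do 2!apply: qact_ncl; exact: ncl_id. Qed.

Lemma aE : a = \sum_(0 <= i < n.+1) q (l i) * q (k i) * q v.
Proof.
rewrite /a d_nclprod; last by move=> i; apply: qact2_ncl.
by apply: eq_bigr => i _; apply: d_qact2.
Qed.

Lemma bE : b = \sum_(0 <= i < n) q (l i) * q (k i.+1) * q v.
Proof.
rewrite /b d_nclprod; last by move=> i; apply: qact2_ncl.
by apply: eq_bigr => i _; apply: d_qact2.
Qed.

Lemma rem_memN i j : (j < n.+1)%N -> j != i -> j \in rem i N.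
Proof.
move=> j_n ji; rewrite mem_rem_uniq ?iota_uniq // inE /= ji.
by rewrite mem_index_iota.
Qed.

Lemma sum_pick m i (F : nat -> R) : (i < m)%N ->
  (forall j, (j < m)%N -> j != i -> F j = 0) -> \sum_(0 <= j < m) F j = F i.
Proof.
move=> i_m F0; rewrite (bigD1_seq i) ?mem_index_iota ?iota_uniq //=.
rewrite big_nat_cond big1 ?addr0 // => j /andP[/andP[_ j_m] ji]; exact: F0.
Qed.

Lemma q_qprodC y f s : q y * qprod f s = qprod f s * q y.
Proof. exact: q_spanC (qprod_span f s). Qed.

Lemma chain_xk i j : (j < n.+1)%N -> j != i -> x i * q (k j) = 0.
Proof. by move=> j_n ji; rewrite -q_qprodC qprod_null ?rem_memN. Qed.

Lemma chain_tl i j : (j < n.+1)%N -> j != i -> q (l j) * t i = 0.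
Proof. by move=> j_n ji; rewrite qprod_null ?rem_memN. Qed.

Lemma chain_xkk i : (i < n.+1)%N -> x i * q (k i) = qprod k N.
Proof. by move=> i_n; rewrite -q_qprodC qprod_rem ?mem_index_iota. Qed.

Lemma chain_tll i : (i < n.+1)%N -> q (l i) * t i = qprod l N.
Proof. by move=> i_n; rewrite qprod_rem ?mem_index_iota. Qed.

Lemma chain_xa i : (i < n.+1)%N -> x i * a = q (l i) * qprod k N * q v.
Proof.
move=> i_n; rewrite aE mulr_sumr (sum_pick i_n) => [|j j_n ji].
  by rewrite !mulrA -(q_qprodC (l i)) -(mulrA (q _)) chain_xkk.
by rewrite !mulrA -(q_qprodC (l j)) -(mulrA (q _)) chain_xk // mulr0 mul0r.
Qed.

Lemma chain_xb i : (i < n)%N -> x i.+1 * b = q (l i) * qprod k N * q v.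
Proof.
move=> i_n; rewrite bE mulr_sumr (sum_pick i_n) => [|j j_n ji].
  by rewrite !mulrA -(q_qprodC (l i)) -(mulrA (q _)) chain_xkk.
by rewrite !mulrA -(q_qprodC (l j)) -(mulrA (q _)) chain_xk // mulr0 mul0r.
Qed.

Lemma chain_term i j y : q (l j) * q (k y) * q v * t i = q (k y) * (q (l j) * t i) * q v.
Proof.
rewrite -mulrA (q_qprodC v) mulrA; congr (_ * _).
by rewrite -(q_spanC _ (q_span _)) mulrA.
Qed.

Lemma chain_at i : (i < n.+1)%N -> a * t i = q (k i) * qprod l N * q v.
Proof.
move=> i_n; rewrite aE mulr_suml (sum_pick i_n) => [|j j_n ji].
  by rewrite chain_term chain_tll.
by rewrite chain_term chain_tl // mulr0 mul0r.
Qed.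

Lemma chain_bt i : (i < n)%N -> b * t i = q (k i.+1) * qprod l N * q v.
Proof.
move=> i_n; rewrite bE mulr_suml (sum_pick i_n) => [|j j_n ji].
  by rewrite chain_term chain_tll // ltnW.
by rewrite chain_term chain_tl ?mulr0 ?mul0r // ltnW.
Qed.

(** Only [l j] with [j < n] enter [b], and all of them occur in [t n]. *)
Lemma chain_btn : b * t n = 0.
Proof.
rewrite bE mulr_suml big_nat big1 // => j /andP[_ j_n].
by rewrite chain_term chain_tl ?mulr0 ?mul0r ?ltn_eqF // ltnW.
Qed.

Lemma chain_xat : x 0 * a * t 0 = qprod k N * qprod l N * q v.
Proof.
rewrite chain_xa // -(mulrA _ (q v)) (q_qprodC v) mulrA.
by rewrite q_qprodC -(mulrA (qprod _ _)) chain_tll.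
Qed.

End Chain.

(* From [x 0], the relation [y' * b = y * a] has a chain of length [n]; the dual
   chain [t] forbids any longer one. *)
Lemma long_chain n v k l : exists al be : G,
  let a := d v * d al in let b := d v * d be in exists x t : nat -> R,
  [/\ forall i, (i < n)%N -> x i.+1 * b = x i * a,
      forall i, (i < n)%N -> a * t i.+1 = b * t i,
      b * t n = 0 &
      x 0%N * a * t 0%N = qprod k (index_iota 0 n.+1) * qprod l (index_iota 0 n.+1) * q v].
Proof.
exists (alpha n v k l), (beta n v k l) => /=.
exists (fun i => qprod k (rem i (index_iota 0 n.+1))).
exists (fun i => qprod l (rem i (index_iota 0 n.+1))); split.
- by move=> i i_n; rewrite chain_xb // chain_xa // ltnW.
- by move=> i i_n; rewrite chain_bt // chain_at.
- exact: chain_btn.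
- exact: chain_xat.
Qed.

End ThreeEngelRing.

(** * Abelian normal sections *)

Record asection (G : groupType) := ASection {
  top : set G;
  bot : set G;
  top_sub : is_subgroup top;
  bot_sub : is_subgroup bot;
  bot_top : bot `<=` top;
  top_conj : forall x y, top x -> top (x ^ y)%g;
  bot_conj : forall x y, bot x -> bot (x ^ y)%g;
  top_comm : forall x y, top x -> top y -> bot [~ x, y]%g
}.

Section Quotient.
Variables (G : groupType) (s : asection G).
Local Open Scope group_scope.

(** The quotient is formed on the type [G] itself, with elements outside [top s] counted as 1. *)
Definition intop (u : G) : G := if `[<top s u>] then u else 1.

Lemma intopP u : top s (intop u).
Proof.
rewrite /intop; case: asboolP => // _; exact: subgroup1 (top_sub s).
Qed.

Lemma intop_id u : top s u -> intop u = u.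
Proof. by rewrite /intop => su; rewrite asboolT. Qed.

Definition cong (u v : G) : bool := `[<bot s ((intop u)^-1 * intop v)>].

Lemma cong_refl : reflexive cong.
Proof. by move=> u; apply/asboolP; rewrite mulVg; exact: subgroup1 (bot_sub s). Qed.

Lemma cong_sym : symmetric cong.
Proof.
move=> u v; apply/asbool_equiv_eq; split=> /(subgroupV (bot_sub s));
by rewrite invgM invgK.
Qed.

Lemma cong_trans : transitive cong.
Proof.
move=> v u w /asboolP uv /asboolP vw; apply/asboolP.
by have := subgroupM (bot_sub s) uv vw; rewrite !mulgA mulgK.
Qed.

Canonical cong_equiv := EquivRel cong cong_refl cong_sym cong_trans.

Definition quo : Type := {eq_quot cong_equiv}%qT.
HB.instance Definition _ := Choice.on quo.

Definition cls (u : G) : quo := (\pi_({eq_quot cong_equiv}) u)%qT.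
Definition rep (m : quo) : G :=
  intop (generic_quotient.repr (m : {eq_quot cong_equiv}%qT)).

Lemma cls_eq u v : top s u -> top s v -> cls u = cls v <-> bot s (u^-1 * v).
Proof.
move=> su sv; split=> [/eqquotP/asboolP|uv]; first by rewrite !intop_id.
by apply/eqquotP/asboolP; rewrite !intop_id.
Qed.

Lemma rep_top m : top s (rep m). Proof. exact: intopP. Qed.

Lemma repK m : cls (rep m) = m.
Proof.
rewrite -[RHS](generic_quotient.reprK (m : {eq_quot cong_equiv}%qT));
  apply/eqquotP/asboolP.
rewrite intop_id ?mulVg; last exact: rep_top.
exact: subgroup1 (bot_sub s).
Qed.

Lemma cls_rep u : top s u -> bot s ((rep (cls u))^-1 * u).
Proof. by move=> su; apply/cls_eq; rewrite ?repK //; exact: rep_top. Qed.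

Definition qadd (m1 m2 : quo) : quo := cls (rep m1 * rep m2).
Definition qopp (m : quo) : quo := cls (rep m)^-1.

Lemma topM u v : top s u -> top s v -> top s (u * v).
Proof. exact: subgroupM (top_sub s). Qed.

Lemma topV u : top s u -> top s u^-1.
Proof. exact: subgroupV (top_sub s). Qed.

Lemma cls_qadd u v : top s u -> top s v -> cls (u * v) = qadd (cls u) (cls v).
Proof.
move=> su sv; apply/esym/cls_eq; try exact: topM.
  by apply: topM; exact: rep_top.
have := subgroupM (bot_sub s) (bot_conj v (cls_rep su)) (cls_rep sv).
set a := rep _; set b := rep _ => ab.
have := subgroupM (bot_sub s) (bot_conj b (cls_rep su)) (cls_rep sv).
by rewrite conjgE invgM !mulgA mulgK.
Qed.

Lemma qaddA : associative qadd.
Proof.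
move=> m1 m2 m3; rewrite -[m1]repK -[m2]repK -[m3]repK.
have t m := rep_top m.
by rewrite -!cls_qadd ?mulgA //; apply: topM.
Qed.

Lemma qaddC : commutative qadd.
Proof.
move=> m1 m2; rewrite -[m1]repK -[m2]repK.
have t m := rep_top m; rewrite -!cls_qadd //.
apply/cls_eq; try exact: topM.
by rewrite invgM -mulgA; exact: top_comm (t m2) (t m1).
Qed.

Lemma qadd0 : left_id (cls 1) qadd.
Proof.
move=> m; rewrite -[m]repK -cls_qadd ?mul1g //; last exact: rep_top.
exact: subgroup1 (top_sub s).
Qed.

Lemma qaddN : left_inverse (cls 1) qopp qadd.
Proof.
move=> m; rewrite -{2}[m]repK /qopp -cls_qadd ?mulVg //;
  first exact: topV (rep_top m).
exact: rep_top.
Qed.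

HB.instance Definition _ := GRing.isZmodule.Build quo qaddA qaddC qadd0 qaddN.

Lemma clsM u v : top s u -> top s v -> cls (u * v) = (cls u + cls v)%R.
Proof. exact: cls_qadd. Qed.

Lemma cls1 : cls 1 = 0%R. Proof. by []. Qed.

Lemma clsV u : top s u -> cls u^-1 = (- cls u)%R.
Proof.
move=> su; apply/eqP; rewrite -addr_eq0 -clsM ?mulVg ?cls1 //; exact: topV.
Qed.

Lemma clsX u n : top s u -> cls (u ^+ n) = (cls u *+ n)%R.
Proof.
move=> su; have sX m : top s (u ^+ m).
  elim: m => [|m IHm]; first exact: subgroup1 (top_sub s).
  by rewrite expgS; apply: topM.
elim: n => [|n IHn]; first by rewrite mulr0n.
by rewrite expgS mulrS clsM ?IHn.
Qed.

Lemma cls0 u : top s u -> cls u = 0%R <-> bot s u.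
Proof.
move=> su; rewrite -cls1; split=> [/esym/cls_eq|bu].
  by rewrite invg1 mul1g; apply=> //; exact: subgroup1 (top_sub s).
apply/esym/cls_eq => //; rewrite ?invg1 ?mul1g //.
exact: subgroup1 (top_sub s).
Qed.

Lemma quo_ind (P : quo -> Prop) :
  (forall u, top s u -> P (cls u)) -> forall m, P m.
Proof. by move=> Pc m; rewrite -[m]repK; apply: Pc; exact: rep_top. Qed.

Definition qconj (x : G) (m : quo) : quo := cls (rep m ^ x).

Lemma cls_conj u x : top s u -> cls (u ^ x) = qconj x (cls u).
Proof.
move=> su; apply/esym/cls_eq; try exact: top_conj.
  by apply: top_conj; exact: rep_top.
by rewrite -conjVg -conjMg; apply/bot_conj/cls_rep.
Qed.

Lemma qconjD x : {morph qconj x : m1 m2 / (m1 + m2)%R}.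
Proof.
elim/quo_ind => u su; elim/quo_ind => v sv.
rewrite -clsM // -!cls_conj //; last exact: topM.
by rewrite conjMg clsM //; exact: top_conj.
Qed.

Lemma qconj1 m : qconj 1 m = m.
Proof. by elim/quo_ind: m => u su; rewrite -cls_conj ?conjg1. Qed.

Lemma qconjM x y m : qconj (x * y) m = qconj y (qconj x m).
Proof.
elim/quo_ind: m => u su; rewrite -!cls_conj ?conjgM //; exact: top_conj.
Qed.

End Quotient.

(** * The endomorphism ring of an abelian group *)

Section EndomorphismRing.
Variable M : zmodType.

Definition endo := {f : M -> M | {morph f : x y / x + y}}.

HB.instance Definition _ := gen_eqMixin endo.
HB.instance Definition _ := gen_choiceMixin endo.

Lemma endoP (f g : endo) : sval f =1 sval g -> f = g.
Proof. by case: f g => [f fD] [g gD] /= /funext fg; apply: eq_exist. Qed.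

Lemma endoD (f : endo) x y : sval f (x + y) = sval f x + sval f y.
Proof. exact: (svalP f). Qed.

Lemma endo_0 (f : endo) : sval f 0 = 0.
Proof. by apply: (@addrI _ (sval f 0)); rewrite -endoD !addr0. Qed.

Program Definition endo_add (f g : endo) : endo :=
  exist _ (fun x => sval f x + sval g x) _.
Next Obligation. by move=> x y /=; rewrite !endoD addrACA. Qed.

Program Definition endo_opp (f : endo) : endo := exist _ (fun x => - sval f x) _.
Next Obligation. by move=> x y /=; rewrite !endoD opprD. Qed.

Program Definition endo_zero : endo := exist _ (fun=> 0) _.
Next Obligation. by move=> x y /=; rewrite addr0. Qed.

Program Definition endo_one : endo := exist _ id _.
Next Obligation. by []. Qed.

(* Endomorphisms act on the right. *)
Program Definition endo_mul (f g : endo) : endo :=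
  exist _ (fun x => sval g (sval f x)) _.
Next Obligation. by move=> x y /=; rewrite !endoD. Qed.

Lemma endo_addA : associative endo_add.
Proof. by move=> f g h; apply: endoP => x /=; rewrite addrA. Qed.
Lemma endo_addC : commutative endo_add.
Proof. by move=> f g; apply: endoP => x /=; rewrite addrC. Qed.
Lemma endo_add0 : left_id endo_zero endo_add.
Proof. by move=> f; apply: endoP => x /=; rewrite add0r. Qed.
Lemma endo_addN : left_inverse endo_zero endo_opp endo_add.
Proof. by move=> f; apply: endoP => x /=; rewrite addNr. Qed.

HB.instance Definition _ :=
  GRing.isZmodule.Build endo endo_addA endo_addC endo_add0 endo_addN.

Lemma endo_mulA : associative endo_mul.
Proof. by move=> f g h; apply: endoP. Qed.
Lemma endo_mul1 : left_id endo_one endo_mul.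
Proof. by move=> f; apply: endoP. Qed.
Lemma endo_1mul : right_id endo_one endo_mul.
Proof. by move=> f; apply: endoP. Qed.
Lemma endo_mulDl : left_distributive endo_mul +%R.
Proof. by move=> f g h; apply: endoP => x /=; rewrite endoD. Qed.
Lemma endo_mulDr : right_distributive endo_mul +%R.
Proof. by move=> f g h; apply: endoP. Qed.

HB.instance Definition _ := GRing.Zmodule_isPzRing.Build endo
  endo_mulA endo_mul1 endo_1mul endo_mulDl endo_mulDr.

End EndomorphismRing.

(** The right side is the difference of the derivatives that [tangentM] produces for the words
    [y * h^-1 * y * h] and [h^-1 * y * h * y], where [h = y ^ x]. *)
Lemma fox_ring (R : pzRingType) (c c' X Y : R) : 5%:R = 0 :> R ->
  c' * Y * c - X * c' * Y * c + c + X + X * c' * Y * c * Y - c * Y - X * Y - 1 =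
  ((1 * c' + - (X * c')) * Y + 1) * c + X - ((((- (X * c')) * Y + 1) * c + X) * Y + 1).
Proof.
move=> R5; have nw w : pred0 w -> \prod_(i <- w) [:: c; c'; X; Y]`_i = 0 by [].
nc_ring R5 [:: c; c'; X; Y] nw.
Qed.

(** * The conjugation action on an abelian normal section *)

Section SectionAction.
Variables (G : groupType) (s : asection G).
Local Open Scope group_scope.

Definition comms (u : G) (xs : seq G) : G := foldl (@commg G) u xs.

Definition qrho (x : G) : endo (quo s) := exist _ (qconj x) (@qconjD G s x).

Lemma qrho1 : qrho 1 = 1%R.
Proof. by apply: endoP => m /=; rewrite qconj1. Qed.

Lemma qrhoM x y : qrho (x * y) = (qrho x * qrho y)%R.
Proof. by apply: endoP => m /=; rewrite qconjM. Qed.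

Lemma cls_commg u x : top s u -> cls s [~ u, x] = sval (d qrho x) (cls s u).
Proof.
move=> su; have sV := topV su; have sJ := top_conj x su.
by rewrite commgEl (clsM sV sJ) (clsV su) (cls_conj x su) addrC.
Qed.

Lemma top_commg u x : top s u -> top s [~ u, x].
Proof. by move=> su; rewrite commgEl; apply: topM (topV su) (top_conj _ su). Qed.

Lemma cls_comms u xs : top s u ->
  cls s (comms u xs) = sval (\prod_(x <- xs) d qrho x)%R (cls s u).
Proof.
elim: xs u => [|x xs IHxs] u su /=; first by rewrite big_nil.
by rewrite big_cons IHxs ?cls_commg //; exact: top_commg.
Qed.

Lemma top_comms u xs : top s u -> top s (comms u xs).
Proof. by elim: xs u => [//|x xs IHxs] u su /=; apply/IHxs/top_commg. Qed.

(* First-order variations: [u] equals [w] up to an element of [top s] whose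
   class depends linearly, through [f], on the parameter [m]. *)
Definition tangent (m : quo s) (w : G) (f : endo (quo s)) (u : G) :=
  exists n, [/\ top s n, u = w * n & cls s n = sval f m].

Lemma tangentM m w f u w' f' u' : tangent m w f u -> tangent m w' f' u' ->
  tangent m (w * w') (f * qrho w' + f')%R (u * u').
Proof.
move=> [n [sn -> En]] [n' [sn' -> En']]; exists (n ^ w' * n'); split.
- by apply: topM => //; exact: top_conj.
- by rewrite conjgE !mulgA mulgK.
- by rewrite clsM ?cls_conj ?En ?En' //; exact: top_conj.
Qed.

Lemma tangentV m w f u : tangent m w f u ->
  tangent m w^-1 (- (f * qrho w^-1))%R u^-1.
Proof.
move=> [n [sn -> En]]; exists ((n ^ w^-1)^-1); split.
- by apply: topV; exact: top_conj.
- by rewrite -conjVg invgM conjgE invgK !mulgA mulVg mul1g.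
- by rewrite clsV ?cls_conj ?En //; exact: top_conj.
Qed.

Lemma tangent_uniq m w f f' u :
  tangent m w f u -> tangent m w f' u -> sval f m = sval f' m.
Proof. by move=> [n [_ -> En]] [n' [_ /mulgI nn' En']]; rewrite -En nn'. Qed.

Hypothesis engel : three_engel G.
Hypothesis R5 : (5%:R = 0 :> endo (quo s))%R.

Lemma commute_conj (x y z : G) : @commute G x y -> @commute G (x ^ z) (y ^ z).
Proof. by rewrite /commute -!conjMg => ->. Qed.

(** With [c = y ^ x], [[~ x, y, y]] is [((y^-1) ^ c^-1) ^ y * y], which commutes with [y] by the
    Engel identity. Conjugate by [y^-1], then by [c]. *)
Lemma engel_commute (x y : G) : @commute G y (y ^ (y ^ x)).
Proof.
set c := y ^ x; have /eqP/commgP := engel x y.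
have -> : [~ x, y, y] = ((y^-1) ^ c^-1) ^ y * y.
  rewrite (commgEl [~ x, y]) (commgEr x) conjVg -/c !conjgE !invgM !invgK.
  by rewrite !mulgA.
move=> cy; have {}cy : @commute G y (((y^-1) ^ c^-1) ^ y).
  by apply: (mulIg y); rewrite -mulgA cy mulgA.
have {}cy := commute_conj c (commute_conj y^-1 cy).
have yy : y ^ y^-1 = y by rewrite conjgE invgK mulgV mulg1.
rewrite conjgK conjgKV yy in cy.
by have := commuteV cy; rewrite invgK => /commute_sym.
Qed.

(** [engel_commute] holds at [y] and at [y * n] for every [n] in [top s], so its two sides have the
    same first-order variation. *)
Lemma fox_section x y : let c := qrho (y ^ x) in
  let c' := qrho (y ^ x)^-1 in
  (c' * qrho y * c - qrho x * c' * qrho y * c + c + qrho x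
  + qrho x * c' * qrho y * c * qrho y - c * qrho y - qrho x * qrho y - 1 = 0)%R.
Proof.
move=> c c'; apply: endoP => m.
elim/quo_ind: m => n sn; set m := cls s n.
have Ty : tangent m y 1%R (y * n) by exists n.
have Tc : tangent m (y ^ x) (qrho x) ((y * n) ^ x).
  by exists (n ^ x); split; [exact: top_conj | rewrite conjMg | exact: cls_conj].
have T1 := tangentM (tangentM (tangentM Ty (tangentV Tc)) Ty) Tc.
have T2 := tangentM (tangentM (tangentM (tangentV Tc) Ty) Tc) Ty.
have Ew z : (z ^ x)^-1 * z * z ^ x * z = z * (z ^ x)^-1 * z * z ^ x.
  by rewrite -!(mulgA z) -[_^-1 * z * _]mulgA; exact: (esym (engel_commute x z)).
rewrite !Ew in T2; have := tangent_uniq T1 T2.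
have E (F1 F2 : endo (quo s)) : (sval F1 m - sval F2 m = sval (F1 - F2) m)%R by [].
by move/eqP; rewrite -subr_eq0 E -fox_ring // => /eqP.
Qed.

Hypothesis ncl3 : forall v u1 u2 u3 : G, normal_closure v u1 ->
  normal_closure v u2 -> normal_closure v u3 -> [~ u1, u2, u3] = 1.

(** The product acts as [[~ u, u1, u2, u3]], and [[~ u, u1]] already lies in the normal closure of
    [v]. *)
Lemma d_qrho3 v u1 u2 u3 : normal_closure v u1 ->
  normal_closure v u2 -> normal_closure v u3 ->
  (d qrho u1 * d qrho u2 * d qrho u3 = 0)%R.
Proof.
move=> v1 v2 v3; apply: endoP; elim/quo_ind => u su.
transitivity (sval (\prod_(x <- [:: u1; u2; u3]) d qrho x)%R (cls s u)).
  by rewrite !big_cons big_nil mulr1 mulrA.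
rewrite -cls_comms //= (ncl3 (v := v)) //; exact: ncl_commr.
Qed.

Local Notation qq := (q qrho).

Lemma section_nilpotent N :
    (forall xs : seq G, size xs = N -> \prod_(x <- xs) qq x = 0)%R ->
  forall u xs, top s u -> size xs = (3 * N)%N -> bot s (comms u xs).
Proof.
move=> q0 u xs su size_xs; apply/cls0; first exact: top_comms.
have := d_nilpotent R5 qrho1 qrhoM d_qrho3 fox_section (k := N) (r :=
  1%R) _ size_xs.
rewrite cls_comms // mul1r => -> // ys size_ys; rewrite mul1r; exact: q0.
Qed.

(** Phrased with elements of [G] instead of operators, so that automorphisms visibly preserve it. *)
Definition chain_from n (u v al be : G) := exists f : nat -> G,
  [/\ f 0%N = u, forall i, (i <= n)%N -> top s (f i) &
      forall i, (i < n)%N -> bot s ([~ f i.+1, v, be]^-1 * [~ f i, v, al])].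

Lemma cls_rel u u' v al be : top s u -> top s u' ->
  bot s ([~ u', v, be]^-1 * [~ u, v, al]) <->
  sval (d qrho v * d qrho be)%R (cls s u') = sval (d qrho v * d qrho al)%R (cls s u).
Proof.
move=> su su'; have st w : top s w -> top s [~ w, v] by apply: top_commg.
rewrite -[sval _ (cls s u')]/(sval _ (sval _ _)) -[sval _ (cls s u)]/(sval _ (sval _ _)).
by rewrite -!cls_commg ?cls_eq //; do ?[exact: st | apply: top_commg; exact: st].
Qed.

Lemma section_chain n (xs : seq G) : size xs = ((2 * n.+1).+1)%N ->
  (\prod_(x <- xs) qq x != 0)%R ->
  exists u v al be, chain_from n u v al be /\ ~ chain_from n.+1 u v al be.
Proof.
move=> size_xs.
(* The list splits into [n + 1] values of [k], [n + 1] values of [l], and [v]. *)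
pose k i := nth 1 xs i; pose l i := nth 1 xs (n.+1 + i)%N; pose v :=
  nth 1 xs (2 * n.+1)%N.
have -> : (\prod_(x <- xs) qq x = qprod qrho k (index_iota 0 n.+1) *
   qprod qrho l (index_iota 0 n.+1) * qq v)%R.
  rewrite (big_nth 1) size_xs big_nat_recr //= mul2n -addnn.
  rewrite (big_cat_nat _ (n := n.+1)) //= ?leq_addr // /qprod.
  congr (_ * _ * qq _)%R; last by rewrite /v mul2n -addnn.
  rewrite -{1}[n.+1]add0n big_addn addnK.
  by apply: eq_bigr => i _; rewrite /l addnC.
move=> P0; have [al [be]] := long_chain R5 qrho1 qrhoM d_qrho3 fox_section n v k l.
move=> [x [t [xb at_ bt0 xat]]]; rewrite -xat in P0.
(* The chain is evaluated at a point that the nonzero product does not kill. *)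
have [z z0] : exists z, sval (x 0%N * (d qrho v * d qrho al) * t 0%N)%R z <> 0%R.
  apply: contrapT => z0; case/eqP: P0; apply: endoP => z.
  by apply: contrapT => z1; apply: z0; exists z.
pose f i := rep (sval (x i) z).
have sf i : top s (f i) by exact: rep_top.
exists (f 0%N), v, al, be; split.
  exists f; split=> // i i_n; apply/cls_rel => //; rewrite !repK.
  exact: (congr1 (fun h : endo _ => sval h z) (xb i i_n)).
move=> [h [h0 sh bh]].
have hE i : (i <= n)%N -> sval (d qrho v * d qrho be)%R (cls s (h i.+1)) =
    sval (d qrho v * d qrho al)%R (cls s (h i)).
  by move=> i_n; apply/cls_rel; [exact/sh/ltnW | exact: sh | exact: bh].
have mE (F1 F2 : endo (quo s)) m : sval (F1 * F2)%R m = sval F2 (sval F1 m) by [].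
(* Descending induction along the dual chain: [a * t i] at [h i] equals [b * t i] at [h i.+1], which
   is 0 for [i = n] and [a * t i.+1] at [h i.+1] for [i < n]. The case [i = 0] contradicts the
   choice of [z]. *)
have at0 i : (i <= n)%N -> sval (d qrho v * d qrho al * t i)%R (cls s (h i)) = 0%R.
  move=> i_n; rewrite -(subKn i_n); elim: (n - i)%N (leq_subr i n) => [|j IHj] j_n.
    by rewrite subn0 mE -hE // -mE bt0.
  have jn : (n - j.+1 < n)%N by rewrite ltn_subrL (leq_trans _ j_n).
  have e : ((n - j.+1).+1)%N = (n - j)%N by rewrite subnSK.
  by rewrite mE -hE ?leq_subr // -mE -at_ // e IHj // ltnW.
apply: z0; have := at0 0%N isT; rewrite h0 repK => <-.
by rewrite -mulrA.
Qed.

End SectionAction.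

(** * Normal closures of elements have class 2 *)

Section CommutatorIdentities.
Variable G : groupType.
Local Open Scope group_scope.
Implicit Types x y z : G.

Lemma commMg x y z : [~ x * y, z] = [~ x, z] ^ y * [~ y, z].
Proof. by rewrite /commg /conjg !invgM !mulgA !(mulgK, mulgVK). Qed.

Lemma commgM x y z : [~ x, y * z] = [~ x, z] * [~ x, y] ^ z.
Proof. by rewrite /commg /conjg !invgM !mulgA !(mulgK, mulgVK). Qed.

Lemma conjg_comm x y : x ^ y = x * [~ x, y].
Proof. by rewrite commgEl mulVKg. Qed.

Lemma Hall_Witt x y z :
  [~ x, y^-1, z] ^ y * [~ y, z^-1, x] ^ z * [~ z, x^-1, y] ^ x = 1.
Proof. by rewrite /commg /conjg !invgM !invgK !mulgA !(mulgK, mulgVK) mulVg. Qed.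

End CommutatorIdentities.

Lemma mulrn_gcd (M : zmodType) (m : M) a b :
  m *+ a = 0 -> m *+ b = 0 -> m *+ gcdn a b = 0.
Proof.
case: (posnP a) => [-> _|a_gt0 ma mb]; first by rewrite gcd0n.
have [c _ /dvdnP[e]] := Bezoutl b a_gt0.
move/(congr1 (fun i => m *+ i));
  rewrite mulrnDr mulnC [(e * a)%N]mulnC !mulrnA ma mb.
by rewrite !mul0rn addr0.
Qed.

Section ClassTwo.
Variable G : groupType.
Local Open Scope group_scope.

Hypotheses (engel : three_engel G) (fiveG : is_pgroup 5 G).

Variable g : G.
Let V := normal_closure g.

Definition gamma3 : set G := smallest (@is_subgroup G)
  [set x | exists u v w, [/\ V u, V v, V w & x = [~ u, v, w]]].
(** Commutators are taken with all of [G], so that [G] acts trivially on the quotient of [gamma3] by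
    [gamma4]. *)
Definition gamma4 : set G := smallest (@is_subgroup G)
  [set [~ w, x] | w in gamma3 & x in setT].

Let Vs : is_subgroup V := ncl_subgroup g.
Let VJ x y (Vx : V x) : V (x ^ y) := ncl_conj y Vx.

Lemma gamma3_conj x y : gamma3 x -> gamma3 (x ^ y).
Proof.
apply: smallest_conj => _ {}y [u [v [w [Vu Vv Vw ->]]]].
by exists (u ^ y), (v ^ y), (w ^ y); rewrite !conjRg; split=> //; exact: VJ.
Qed.

Lemma gamma4_conj x y : gamma4 x -> gamma4 (x ^ y).
Proof.
apply: smallest_conj => _ {}y [w Ww [z _ <-]].
exists (w ^ y); first exact: gamma3_conj.
by exists (z ^ y); rewrite ?conjRg.
Qed.

Let Ws : is_subgroup gamma3 := subgroup_smallest _.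
Let Ns : is_subgroup gamma4 := subgroup_smallest _.

Lemma gamma4_comm w x : gamma3 w -> gamma4 [~ w, x].
Proof. by move=> Ww; apply: sub_gen_smallest; exists w => //; exists x. Qed.

Lemma gamma4_sub : gamma4 `<=` gamma3.
Proof.
apply: smallest_sub => // _ [w Ww [x _ <-]]; rewrite commgEl.
exact: subgroupM Ws (subgroupV Ws Ww) (gamma3_conj x Ww).
Qed.

Lemma gamma3_comm x y : gamma3 x -> gamma3 y -> gamma4 [~ x, y].
Proof. by move=> Wx _; exact: gamma4_comm. Qed.

Definition gamma_section : asection G :=
  ASection Ws Ns gamma4_sub gamma3_conj gamma4_conj gamma3_comm.

Let c x : quo gamma_section := cls gamma_section x.
(** Trilinear on [V]: the corrections in the commutator expansions are conjugations of, or
    commutators with, elements of [gamma3], invisible modulo [gamma4]. *)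
Let f u v w : quo gamma_section := c [~ u, v, w].

Lemma gamma3_gen u v w : V u -> V v -> V w -> gamma3 [~ u, v, w].
Proof. by move=> Vu Vv Vw; apply: sub_gen_smallest; exists u, v, w. Qed.

Lemma cJ x y : gamma3 x -> c (x ^ y) = c x.
Proof.
move=> Wx; apply/esym/cls_eq => //; first exact: gamma3_conj.
exact: gamma4_comm.
Qed.

Lemma cM x y : gamma3 x -> gamma3 y -> c (x * y) = (c x + c y)%R.
Proof. exact: (@clsM _ gamma_section). Qed.

Lemma c_comm0 x y : gamma3 x -> c [~ x, y] = 0%R.
Proof.
move=> Wx; apply/cls0; last exact: gamma4_comm.
exact: gamma4_sub (gamma4_comm _ Wx).
Qed.

Lemma c_commM a b w : gamma3 [~ a, w] -> gamma3 [~ b, w] ->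
  c [~ a * b, w] = (c [~ a, w] + c [~ b, w])%R.
Proof.
by move=> Wa Wb; rewrite commMg (cM (gamma3_conj b Wa) Wb) cJ.
Qed.

Lemma c_commW a z w : gamma3 [~ a, w] -> gamma3 z -> c [~ a * z, w] = c [~ a, w].
Proof.
move=> Wa Wz; have Wzw := gamma4_sub (gamma4_comm w Wz).
by rewrite c_commM // (c_comm0 w Wz) addr0.
Qed.

Lemma fDl u u' v w : V u -> V u' -> V v -> V w ->
  f (u * u') v w = (f u v w + f u' v w)%R.
Proof.
move=> Vu Vu' Vv Vw; rewrite /f commMg conjg_comm.
have W1 : gamma3 [~ u, v, w] by exact: gamma3_gen.
have W2 : gamma3 [~ u, v, u'] by exact: gamma3_gen.
have W3 : gamma3 [~ u', v, w] by exact: gamma3_gen.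
have W12 : gamma3 [~ [~ u, v] * [~ u, v, u'], w].
  by rewrite commMg; apply: subgroupM Ws (gamma3_conj _ W1) (gamma4_sub (gamma4_comm _ W2)).
by rewrite c_commM // c_commW.
Qed.

Lemma fDm u v v' w : V u -> V v -> V v' -> V w ->
  f u (v * v') w = (f u v w + f u v' w)%R.
Proof.
move=> Vu Vv Vv' Vw; rewrite /f commgM conjg_comm mulgA.
have W1 : gamma3 [~ u, v, w] by exact: gamma3_gen.
have W2 : gamma3 [~ u, v', w] by exact: gamma3_gen.
have W3 : gamma3 [~ u, v, v'] by exact: gamma3_gen.
have W12 : gamma3 [~ [~ u, v'] * [~ u, v], w].
  by rewrite commMg; apply: subgroupM Ws (gamma3_conj _ W2) W1.
by rewrite c_commW // c_commM // addrC.
Qed.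

Lemma fDr u v w w' : V u -> V v -> V w -> V w' ->
  f u v (w * w') = (f u v w + f u v w')%R.
Proof.
move=> Vu Vv Vw Vw'; have W1 z : V z -> gamma3 [~ u, v, z] by exact: gamma3_gen.
have Ww := W1 w Vw; have Ww' := W1 w' Vw'.
by rewrite /f commgM (cM Ww' (gamma3_conj w' Ww)) addrC cJ.
Qed.

Let VM x y (Vx : V x) (Vy : V y) : V (x * y) := subgroupM Vs Vx Vy.
Let VV x (Vx : V x) : V x^-1 := subgroupV Vs Vx.

Lemma fNl u v w : V u -> V v -> V w -> f u^-1 v w = (- f u v w)%R.
Proof.
move=> Vu Vv Vw; apply/eqP; rewrite -addr_eq0 -fDl ?mulVg //; last exact: VV.
by rewrite /f !comm1g.
Qed.

Lemma fNm u v w : V u -> V v -> V w -> f u v^-1 w = (- f u v w)%R.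
Proof.
move=> Vu Vv Vw; apply/eqP; rewrite -addr_eq0 -fDm ?mulVg //; last exact: VV.
by rewrite /f commg1 comm1g.
Qed.

Lemma fNr u v w : V u -> V v -> V w -> f u v w^-1 = (- f u v w)%R.
Proof.
move=> Vu Vv Vw; apply/eqP; rewrite -addr_eq0 -fDr ?mulVg //; last exact: VV.
by rewrite /f commg1.
Qed.

Lemma f_anti u v w : V u -> V v -> V w -> f v u w = (- f u v w)%R.
Proof.
move=> Vu Vv Vw; apply/eqP; rewrite -addr_eq0; apply/eqP.
rewrite /f -c_commM; [|exact: gamma3_gen..].
by rewrite -(invgR u v) mulVg comm1g.
Qed.

(** The Hall-Witt identity, whose conjugations disappear modulo [gamma4]; its inverted middle
    entries only change the overall sign. *)
Lemma f_jacobi u v w : V u -> V v -> V w -> (f u v w + f v w u + f w u v = 0)%R.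
Proof.
move=> Vu Vv Vw; apply: oppr_inj; rewrite !opprD oppr0 -!fNm //.
have W a b e : V a -> V b -> V e -> gamma3 [~ a, b^-1, e].
  by move=> Va Vb Ve; apply: gamma3_gen => //; exact: VV.
have := congr1 c (Hall_Witt u v w).
have [W1 W2 W3] := And3 (W u v w Vu Vv Vw) (W v w u Vv Vw Vu) (W w u v Vw Vu Vv).
have J x y : gamma3 x -> gamma3 (x ^ y) := @gamma3_conj x y.
rewrite (cM (subgroupM Ws (J _ _ W1) (J _ _ W2)) (J _ _ W3)).
by rewrite (cM (J _ _ W1) (J _ _ W2)) !cJ.
Qed.

(* This cubic identity, polarised, makes [f] antisymmetric in its last two
   arguments on the conjugates of [g]; the Jacobi identity then gives [3 f = 0]. *)
Lemma f_engel x y : V y -> f (y ^ x) y y = 0%R.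
Proof.
move=> Vy; have Vyx := VJ x Vy.
have := engel x y; rewrite (commgEr x) conjVg => /(congr1 c) E.
have := fDl (VV Vyx) Vy Vy Vy; rewrite {1}/f E fNl //.
have -> : f y y y = 0%R by rewrite /f commgg comm1g /c cls1.
by rewrite /c cls1 addr0 => /esym/eqP; rewrite oppr_eq0 => /eqP.
Qed.

Lemma quo_torsion p (m : quo gamma_section) : coprime p 5 -> (m *+ p = 0 -> m = 0)%R.
Proof.
elim/quo_ind: m => w Ww p5 mp; have [k [_ wk _]] := fiveG w.
have mk : (cls gamma_section w *+ 5 ^ k = 0)%R by rewrite -clsX // wk cls1.
have := mulrn_gcd mp mk; rewrite -/(coprime _ _).
by have /eqP -> := coprimeXr k p5; rewrite mulr1n.
Qed.

Let S p a b : quo gamma_section := (f p a b + f p b a)%R.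

(** Put [v * w] for [y] in [f_engel]. Replacing [v] by its inverse preserves the mixed terms of
    degree 2 in [v] and negates those of degree 1, so comparing [u] with [u^-1] isolates twice the
    latter. *)
Lemma f_polar u w x : V u -> V w -> (f (u ^ x) w w + S (w ^ x) u w = 0)%R.
Proof.
move=> Vu Vw.
have E v : V v -> (S (v ^ x) v w + f (w ^ x) v v + (f (v ^ x) w w + S (w ^ x) v w) = 0)%R.
  move=> Vv; have := f_engel x (VM Vv Vw).
  rewrite conjMg fDl; try by do ?[exact: VM | exact: VJ | by []].
  have E1 p : V p -> f p (v * w) (v * w) = (f p v v + S p v w + f p w w)%R.
    move=> Vp; rewrite fDm ?fDr //; try exact: VM.
    by rewrite /S !addrA.
  rewrite !E1; try exact: VJ.
  rewrite !f_engel // add0r addr0.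
  by rewrite addrACA.
have EP := E u Vu; have := E _ (VV Vu).
have Vux := VJ x Vu; have Vwx := VJ x Vw; have Vu' := VV Vu.
rewrite /S conjVg !fNl // !fNm // !fNr // !opprK.
rewrite -!opprD => /eqP; rewrite subr_eq0 => /eqP PQ.
by rewrite /S PQ -mulr2n in EP; apply: (@quo_torsion 2).
Qed.

Let Vg x : V (g ^ x) := ncl_conj x (@ncl_id G g).
Let Vg0 : V g := @ncl_id G g.

Lemma f_sym2 x b : S (g ^ x) (g ^ b) g = 0%R.
Proof.
have := f_polar x (Vg b) Vg0; rewrite -conjgM f_engel ?add0r //.
Qed.

(** Linearise [f_polar] in [w = g ^ b * g]: the other mixed terms end in [g] and vanish by
    [f_sym2]. *)
Lemma f_sym3 x a b : S (g ^ x) (g ^ a) (g ^ b) = 0%R.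
Proof.
have [Vx Va Vb] := And3 (Vg x) (Vg a) (Vg b).
have Vax := VJ x Va; have Vbx := VJ x Vb.
have := f_polar x Va (VM Vb Vg0); have := f_polar x Va Vb; have := f_polar x Va Vg0.
have E p q : V p -> V q -> f p (q * g) (q * g) = (f p q q + f p g g + S p q g)%R.
  move=> Vp Vq; have Vqg := VM Vq Vg0.
  by rewrite fDm // !fDr // /S -!addrA; congr (_ + _)%R; rewrite addrA addrC.
have ES p q : V p -> V q -> S p q (g ^ b * g) = (S p q (g ^ b) + S p q g)%R.
  by move=> Vp Vq; rewrite /S fDm // fDr // addrACA.
have EL p p' u w : V p -> V p' -> V u -> V w -> S (p * p') u w = (S p u w + S p' u w)%R.
  by move=> Vp Vp' Vu Vw; rewrite /S !fDl // addrACA.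
have Vgx := Vg x; have Vgbx : V ((g ^ b) ^ x * g ^ x) by exact: VM.
rewrite (conjMg _ g x) (E _ _ Vax Vb) (ES _ _ Vgbx Va) !(EL _ _ _ _ Vbx Vgx) //.
rewrite -!(conjgM g) !f_sym2 !add0r !addr0.
by move=> E1 E2; rewrite E1 addr0 addrA E2 add0r.
Qed.

Lemma f_conj0 a b e : f (g ^ a) (g ^ b) (g ^ e) = 0%R.
Proof.
have sym p q r : f (g ^ p) (g ^ r) (g ^ q) = (- f (g ^ p) (g ^ q) (g ^ r))%R.
  by apply/eqP; rewrite -addr_eq0; apply/eqP; exact: f_sym3.
have rot p q r : f (g ^ q) (g ^ r) (g ^ p) = f (g ^ p) (g ^ q) (g ^ r).
  by rewrite sym f_anti // opprK.
apply: (@quo_torsion 3) => //; rewrite !mulrS mulr0n addr0 addrA.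
by have := f_jacobi (Vg a) (Vg b) (Vg e); rewrite (rot b e a) !(rot a b e).
Qed.

Lemma ncl_ind (P : G -> Prop) : P 1 -> (forall x, P (g ^ x)) ->
  (forall x y, V x -> V y -> P x -> P y -> P (x * y)) ->
  (forall x, V x -> P x -> P x^-1) -> forall x, V x -> P x.
Proof.
move=> P1 Pg PM PV x Vx.
suff [] : V x /\ P x by [].
apply: (smallest_sub (X := [set x | V x /\ P x])) Vx.
  split=> [|y z [Vy Py] [Vz Pz]]; first by split; [exact: subgroup1 Vs|].
  split; first exact: Vs.2.
  exact: PM Vy (VV Vz) Py (PV _ Vz Pz).
by move=> _ [y _ <-]; split; [exact: Vg | exact: Pg].
Qed.

Lemma f_null u v w : V u -> V v -> V w -> f u v w = 0%R.
Proof.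
move=> Vu Vv Vw; move: u v w Vu Vv Vw.
have f1 a b : forall w, V w -> f (g ^ a) (g ^ b) w = 0%R.
  apply: ncl_ind => [|e|x y Vx Vy IHx IHy|x Vx IHx]; last 2 first.
  - by rewrite fDr // IHx IHy addr0.
  - by rewrite fNr // IHx oppr0.
  - by rewrite /f commg1 /c cls1.
  - exact: f_conj0.
have f2 a w : V w -> forall v, V v -> f (g ^ a) v w = 0%R.
  move=> Vw; apply: ncl_ind => [|b|x y Vx Vy IHx IHy|x Vx IHx].
  - by rewrite /f commg1 comm1g /c cls1.
  - exact: f1.
  - by rewrite fDm // IHx IHy addr0.
  - by rewrite fNm // IHx oppr0.
move=> u v w Vu Vv Vw; move: u Vu.
apply: ncl_ind => [|a|x y Vx Vy IHx IHy|x Vx IHx].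
- by rewrite /f !comm1g /c cls1.
- exact: f2.
- by rewrite fDl // IHx IHy addr0.
- by rewrite fNl // IHx oppr0.
Qed.

(** In a nilpotent group this makes [gamma3] trivial, so that [V] has class at most 2. *)
Lemma gamma3_sub : gamma3 `<=` gamma4.
Proof.
apply: smallest_sub => // _ [u [v [w [Vu Vv Vw ->]]]].
by have /cls0 := f_null Vu Vv Vw; apply; exact: gamma3_gen.
Qed.

End ClassTwo.

(** * Omega-categoricity *)

Section FiniteSubgroup.
Variable G : groupType.
Local Open Scope group_scope.

Record finsubgroup := FinSubgroup {
  elts : seq G;
  elts1 : 1 \in elts;
  eltsM : forall x y, x \in elts -> y \in elts -> x * y \in elts;
  eltsV : forall x, x \in elts -> x^-1 \in elts
}.

Variable F : finsubgroup.

Definition finsub : Type := seq_sub (elts F).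
HB.instance Definition _ := Finite.on finsub.

Definition finsub_mul (x y : finsub) : finsub :=
  SeqSub (eltsM (ssvalP x) (ssvalP y)).
Definition finsub_one : finsub := SeqSub (elts1 F).
Definition finsub_inv (x : finsub) : finsub := SeqSub (eltsV (ssvalP x)).

Lemma finsub_mulA : associative finsub_mul.
Proof. by move=> x y z; apply: val_inj; rewrite /= mulgA. Qed.
Lemma finsub_mul1 : left_id finsub_one finsub_mul.
Proof. by move=> x; apply: val_inj; rewrite /= mul1g. Qed.
Lemma finsub_mulV : left_inverse finsub_one finsub_inv finsub_mul.
Proof. by move=> x; apply: val_inj; rewrite /= mulVg. Qed.

HB.instance Definition _ := Finite_isGroup.Build finsub
  finsub_mulA finsub_mul1 finsub_mulV.

Lemma finsub_valM (x y : finsub) : ssval (x * y) = ssval x * ssval y.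
Proof. by []. Qed.

Lemma finsub_valX (x : finsub) n : ssval (x ^+ n) = ssval x ^+ n.
Proof. by elim: n => [//|n IHn]; rewrite !expgS finsub_valM IHn. Qed.

End FiniteSubgroup.

Lemma lcn_residual (gT : finGroupType) (W : set gT) :
    nilpotent [set: gT]%G ->
    W `<=` smallest (@is_subgroup gT) [set [~ w, x]%g | w in W & x in setT] ->
  forall x, W x -> x = 1%g.
Proof.
move=> /lcnP[n Ln] Wsub x Wx.
suff: x \in 'L_n.+1([set: gT]%G)%g by rewrite Ln => /set1gP.
elim: n {Ln} x Wx => [|n IHn] x Wx; first by rewrite lcn1 inE.
have {Wx} := Wsub x Wx; rewrite lcnSn; move: x.
apply: (smallest_sub (X :=
  [set x | x \in [~: 'L_n.+1([set: gT]%G), [set: gT]%G]%g])).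
  by split=> [|y z /= Ly Lz]; rewrite /= ?group1 // groupM ?groupV.
by move=> _ [w Ww [z _ <-]] /=; rewrite mem_commg ?IHn ?inE.
Qed.

Section OmegaCategorical.
Variable G : groupType.
Local Open Scope group_scope.
Hypothesis omega_cat : omega_categorical G.

Lemma orbit_finite (T : Type) (A : set T) n (f : T -> n.-tuple G) :
    {in A &, forall x y, aut_orbit (f x) = aut_orbit (f y) -> x = y} ->
  finite_set A.
Proof.
move=> finj; rewrite -(eq_finite_set (inj_card_eq (f :=
  fun x => aut_orbit (f x)) finj)).
apply: sub_finite_set (omega_cat n) => _ [x _ <-]; by exists (f x).
Qed.

Lemma aut_orbit_id n (t : n.-tuple G) : aut_orbit t t.
Proof.
exists id; first by split=> //; exists id.
by apply: val_inj; rewrite /= map_id.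
Qed.

(** Otherwise each [i] has a tuple satisfying [P i] but not [P i.+1]; by invariance and monotonicity
    these infinitely many tuples lie in distinct orbits. *)
Lemma omega_stationary n (P : nat -> n.-tuple G -> Prop) :
    (forall i t, P i.+1 t -> P i t) ->
    (forall i t phi, is_automorphism phi -> P i t -> P i (map_tuple phi t)) ->
  exists N, forall t, P N t -> P N.+1 t.
Proof.
move=> Pdecr Paut; apply: contrapT => nP.
have /choice[f fP] : forall i, exists t, P i t /\ ~ P i.+1 t.
  move=> i; apply: contrapT => ni; apply: nP; exists i => t Pt.
  by apply: contrapT => nPt; apply: ni; exists t.
have lt_orbit i j : (i < j)%N -> aut_orbit (f j) (f i) -> False.
  move=> ij [phi aut_phi E]; have [_ nPi] := fP i; apply: nPi; rewrite -E.
  apply: Paut => //; have [Pj _] := fP j.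
  have le_P k l t : (k <= l)%N -> P l t -> P k t.
    by move=> /subnK <-; elim: (l - k)%N => [//|m IHm] /Pdecr/IHm.
  exact: le_P ij Pj.
apply: infinite_nat; apply: (@orbit_finite _ _ n f) => i j _ _ E.
case: (ltngtP i j) => // ij; [case: (lt_orbit i j ij) | case: (lt_orbit j i ij)].
  by rewrite -E; exact: aut_orbit_id.
by rewrite E; exact: aut_orbit_id.
Qed.

Lemma aut1 (phi : G -> G) : is_automorphism phi -> phi 1 = 1.
Proof. by move=> [_ phiM]; apply: (mulgI (phi 1)); rewrite -phiM !mulg1. Qed.

Lemma autV (phi : G -> G) x : is_automorphism phi -> phi x^-1 = (phi x)^-1.
Proof.
move=> aphi; apply: (mulgI (phi x)).
by rewrite mulgV -(aphi.2) mulgV (aut1 aphi).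
Qed.

(** An automorphism fixing [t] fixes the subgroup it generates pointwise, so an element [x] of that
    subgroup is determined by the orbit of [x :: t]. *)
Lemma finite_subgroup n (t : n.-tuple G) :
  finite_set (smallest (@is_subgroup G) [set x | x \in t]).
Proof.
apply: (@orbit_finite _ _ n.+1 (fun x => [tuple of x :: t])) => x y.
rewrite !inE => Hx _ E.
have [phi aphi /(congr1 val) /= [Ex Et]] : aut_orbit [tuple of x :: t] [tuple of y :: t].
  by rewrite E; exact: aut_orbit_id.
rewrite -Ex; apply: esym.
apply: (smallest_sub (X := [set z | phi z = z])) Hx => [|z /= tz].
  split=> [|z w /= Ez Ew]; first exact: aut1.
  by rewrite aphi.2 (autV _ aphi) Ez Ew.
have tz' : (index z t < size t)%N by rewrite index_mem.
by rewrite -{1}(nth_index z tz) -(nth_map z z phi tz') Et nth_index.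
Qed.

Hypotheses (engel : three_engel G) (fiveG : is_pgroup 5 G).

(** The claim lives in the subgroup generated by [g], [a], [b], [e], a finite 5-group and hence
    nilpotent, where [gamma3_sub] applies. *)
Lemma ncl_conj_class2 (g a b e : G) : [~ g ^ a, g ^ b, g ^ e] = 1.
Proof.
pose H := smallest (@is_subgroup G) [set x | x \in [tuple g; a; b; e]].
have sH : is_subgroup H by exact: subgroup_smallest.
have [s Hs] := (finite_seqP _).1 (finite_subgroup [tuple g; a; b; e]).
have memH x : (x \in s) <-> H x by rewrite /H Hs.
have s1 : 1 \in s by apply/memH; exact: subgroup1 sH.
have sM x y : x \in s -> y \in s -> x * y \in s.
  by move=> /memH Hx /memH Hy; apply/memH; exact: subgroupM sH Hx Hy.
have sV x : x \in s -> x^-1 \in s.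
  by move=> /memH Hx; apply/memH; exact: subgroupV sH Hx.
pose F := FinSubgroup s1 sM sV; pose T := finsub F.
have engelT : three_engel T.
  by move=> x y; apply: val_inj; exact: engel (ssval x) (ssval y).
have fiveT : is_pgroup 5 T.
  move=> x; have [k [k0 xk kmin]] := fiveG (ssval x); exists k; split=> //.
    by apply: val_inj; exact: etrans (finsub_valX _ _) xk.
  by move=> m m0 xm; apply: kmin => //; rewrite -finsub_valX xm.
have pT : (5.-group [set: T]%G)%g.
  apply/pnatP => // p p_pr /(Cauchy p_pr)[x _ ox].
  have [k [_ xk _]] := fiveT x.
  move: p_pr; rewrite -ox => p_pr.
  have : (#[x]%g %| 5 ^ k)%N by rewrite order_dvdn xk.
  rewrite Euclid_dvdX // => /andP[]; rewrite dvdn_prime2 // => /eqP -> _;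
    rewrite inE.
have memt x : x \in [tuple g; a; b; e] -> x \in s.
  by move=> tx; apply/memH; apply: sub_gen_smallest; exact: tx.
have [gs as_ bs es] : [/\ g \in s, a \in s, b \in s & e \in s].
  by split; apply: memt; rewrite !inE eqxx ?orbT.
pose gT : T := SeqSub gs; pose aT : T := SeqSub as_; pose bT : T := SeqSub bs.
pose eT : T := SeqSub es.
have gT3 x : gamma3 gT x -> x = 1.
  apply: lcn_residual (pgroup_nil pT) _ _; exact: gamma3_sub engelT fiveT gT.
have : [~ gT ^ aT, gT ^ bT, gT ^ eT] = 1.
  by apply: gT3; apply: gamma3_gen; apply: ncl_conj; exact: ncl_id.
by move=> /(congr1 (@ssval _ _)).
Qed.

Lemma ncl_class2 (v u1 u2 u3 : G) : normal_closure v u1 -> normal_closure v u2 ->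
  normal_closure v u3 -> [~ u1, u2, u3] = 1.
Proof.
pose V := normal_closure v; have sV : is_subgroup V := @ncl_subgroup G v.
(* The commutators are placed in the centraliser of [V] one argument at a time, starting from
   conjugates of [v]. *)
pose Z : set G := [set z | forall w, V w -> commute z w].
have ZM x y : Z x -> Z y -> Z (x * y).
  by move=> Zx Zy w Vw; rewrite /commute -mulgA (Zy w Vw) mulgA (Zx w Vw) mulgA.
have ZV x : Z x -> Z x^-1.
  by move=> Zx w Vw; apply/commute_sym/commuteV/commute_sym/Zx.
have ZJ x y : Z x -> Z (x ^ y).
  move=> Zx w Vw; have := Zx (w ^ y^-1) (ncl_conj _ Vw).
  by move=> /(commute_conj y); rewrite conjgKV.
have Z1 : Z 1 by move=> w _; exact/commute_sym/commute1.
have Zgen a b : Z [~ v ^ a, v ^ b].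
  apply: ncl_ind => [|e|x y _ _ Cx Cy|x _ Cx].
  - exact: commute1.
  - by apply/commgP/eqP; exact: ncl_conj_class2.
  - exact: commuteM.
  - exact: commuteV.
have Z2 b : forall u, V u -> Z [~ u, v ^ b].
  apply: ncl_ind => [|a|x y _ _ Zx Zy|x _ Zx].
  - by rewrite comm1g.
  - exact: Zgen.
  - by rewrite commMg; apply: ZM => //; exact: ZJ.
  - have := commMg x x^-1 (v ^ b); rewrite mulgV comm1g => /esym/mulg1_eq <-.
    exact/ZV/ZJ.
have Z3 u : V u -> forall w, V w -> Z [~ u, w].
  move=> Vu; apply: ncl_ind => [|b|x y _ _ Zx Zy|x _ Zx].
  - by rewrite commg1.
  - exact: Z2.
  - by rewrite commgM; apply: ZM => //; exact: ZJ.
  - have := commgM u x^-1 x; rewrite mulVg commg1 => /esym/mulg1_eq E.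
    by have := ZJ _ x^-1 (ZV _ Zx); rewrite E conjgK.
by move=> Vu1 Vu2 Vu3; apply/eqP/commgP; exact: Z3.
Qed.

End OmegaCategorical.

(** * Nilpotency *)

Section Verbal.
Variables (G : groupType) (g : G).
Local Open Scope group_scope.
Let V := normal_closure g.
Let sV : is_subgroup V := ncl_subgroup g.

Definition ncl_der : set G := smallest (@is_subgroup G)
  [set [~ u, w] | u in V & w in V].

Definition ncl_frat : set G := smallest (@is_subgroup G)
  ([set [~ u, w] | u in V & w in V] `|` [set u ^+ 5 | u in V]).

Lemma ncl_der_comm u w : V u -> V w -> ncl_der [~ u, w].
Proof. by move=> Vu Vw; apply: sub_gen_smallest; exists u => //; exists w. Qed.

Lemma ncl_frat_comm u w : V u -> V w -> ncl_frat [~ u, w].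
Proof.
by move=> Vu Vw; apply: sub_gen_smallest; left; exists u => //; exists w.
Qed.

Lemma ncl_frat_exp u : V u -> ncl_frat (u ^+ 5).
Proof. by move=> Vu; apply: sub_gen_smallest; right; exists u. Qed.

Lemma ncl_derJ x y : ncl_der x -> ncl_der (x ^ y).
Proof.
apply: smallest_conj => _ {}y [u Vu [w Vw <-]]; rewrite conjRg.
exists (u ^ y); first exact: ncl_conj.
by exists (w ^ y); first exact: ncl_conj.
Qed.

Lemma ncl_fratJ x y : ncl_frat x -> ncl_frat (x ^ y).
Proof.
apply: smallest_conj => _ {}y [[u Vu [w Vw <-]]|[u Vu <-]].
  left; rewrite conjRg; exists (u ^ y); first exact: ncl_conj.
  by exists (w ^ y); first exact: ncl_conj.
by right; rewrite conjXg; exists (u ^ y); first exact: ncl_conj.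
Qed.

Lemma ncl_der_sub : ncl_der `<=` V.
Proof. by apply: smallest_sub => // _ [u Vu [w Vw <-]]; exact: ncl_comm. Qed.

Lemma ncl_exp u n : V u -> V (u ^+ n).
Proof.
move=> Vu; elim: n => [|n IHn]; first exact: subgroup1 sV.
by rewrite expgS; exact: subgroupM sV Vu IHn.
Qed.

Lemma ncl_frat_sub : ncl_frat `<=` V.
Proof.
apply: smallest_sub => // _ [[u Vu [w Vw <-]]|[u Vu <-]]; first exact: ncl_comm.
exact: ncl_exp.
Qed.

Definition ab_section : asection G := ASection sV (subgroup_smallest _)
  ncl_der_sub (@ncl_conj G g) ncl_derJ ncl_der_comm.

Definition frat_section : asection G := ASection sV (subgroup_smallest _)
  ncl_frat_sub (@ncl_conj G g) ncl_fratJ ncl_frat_comm.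

Lemma frat_char5 : (5%:R = 0 :> endo (quo frat_section))%R.
Proof.
apply: endoP; elim/quo_ind => u Vu.
have -> : sval (5%:R : endo (quo frat_section))%R (cls frat_section u) =
    (cls frat_section u *+ 5)%R by rewrite !mulrS !mulr0n !addr0.
by rewrite -clsX //; apply/cls0; [exact: ncl_exp | exact: ncl_frat_exp].
Qed.

Lemma frat_cls5 x : ncl_frat x -> exists m, (cls ab_section x = m *+ 5)%R.
Proof.
move=> Fx; suff [] : V x /\ exists m, (cls ab_section x = m *+ 5)%R by [].
move: x Fx; apply: (smallest_sub
    (X := [set x | V x /\ exists m, (cls ab_section x = m *+ 5)%R])).
  split=> [|x y [Vx [mx Ex]] [Vy [my Ey]]].
    by split; [exact: subgroup1 sV | exists 0%R; rewrite mul0rn cls1].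
  split; first exact: sV.2.
  exists (mx - my)%R; rewrite mulrnBl -Ex -Ey clsM ?clsV //.
  exact: subgroupV sV Vy.
move=> _ [[u Vu [w Vw <-]]|[u Vu <-]]; split; try exact: ncl_comm;
  try exact: ncl_exp.
  exists 0%R; rewrite mul0rn; apply/cls0; first exact: ncl_comm.
  exact: ncl_der_comm.
by exists (cls ab_section u); rewrite -clsX.
Qed.

End Verbal.

(** * Invariance of the constructions under automorphisms *)

Section Automorphisms.
Variables (G : groupType) (phi : G -> G).
Hypothesis aphi : is_automorphism phi.
Local Open Scope group_scope.

Lemma autR x y : phi [~ x, y] = [~ phi x, phi y].
Proof. by rewrite !commgEl !conjgE !aphi.2 !(autV _ aphi). Qed.

Lemma autJ x y : phi (x ^ y) = phi x ^ phi y.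
Proof. by rewrite !conjgE !aphi.2 !(autV _ aphi). Qed.

Lemma autX x n : phi (x ^+ n) = phi x ^+ n.
Proof. by elim: n => [|n IHn]; rewrite ?(aut1 aphi) // !expgS aphi.2 IHn. Qed.

Lemma aut_smallest (A B : set G) : (forall x, A x -> B (phi x)) ->
  forall x, smallest (@is_subgroup G) A x -> smallest (@is_subgroup G) B (phi x).
Proof.
move=> AB x; have [B1 BB] := subgroup_smallest B.
apply: (smallest_sub (X := [set x | smallest (@is_subgroup G) B (phi x)])).
  split=> [|u w /= Bu Bw]; first by rewrite /= (aut1 aphi).
  by rewrite aphi.2 (autV _ aphi); exact: BB.
by move=> u /AB Bu; exact: sub_gen_smallest.
Qed.

Lemma aut_ncl g x : normal_closure g x -> normal_closure (phi g) (phi x).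
Proof.
by apply: aut_smallest => _ [y _ <-]; exists (phi y) => //; rewrite autJ.
Qed.

Lemma aut_frat g x : ncl_frat g x -> ncl_frat (phi g) (phi x).
Proof.
apply: aut_smallest => _ [[u Vu [w Vw <-]]|[u Vu <-]].
  left; exists (phi u); first exact: aut_ncl.
  by exists (phi w); [exact: aut_ncl | rewrite autR].
by right; exists (phi u); [exact: aut_ncl | rewrite autX].
Qed.

Lemma aut_chain g n u v al be : chain_from (frat_section g) n u v al be ->
  chain_from (frat_section (phi g)) n (phi u) (phi v) (phi al) (phi be).
Proof.
move=> [f [f0 tf bf]]; exists (phi \o f); split=> [|i i_n|i i_n] /=.
- by rewrite f0.
- exact: aut_ncl (tf i i_n).
- have := aut_frat (bf i i_n); rewrite aphi.2 (autV _ aphi) !autR.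
  exact.
Qed.

End Automorphisms.

(** * From nilpotent actions on sections to nilpotency of the group *)

Section Nilpotency.
Variable G : groupType.
Local Open Scope group_scope.
Hypotheses (omega_cat : omega_categorical G) (engel : three_engel G).
Hypothesis fiveG : is_pgroup 5 G.

(** Stationarity gives [N] such that no element has order exactly [5 ^ N.+1]; passing to fifth
    powers then excludes all larger orders. *)
Lemma exponent_bounded : exists k, forall x : G, x ^+ (5 ^ k) = 1.
Proof.
have [||N PN] := @omega_stationary G omega_cat 1
    (fun i t => tnth t ord0 ^+ (5 ^ i) <> 1).
- by move=> i t; apply: contra_not => ti; rewrite expnSr expgnA ti expg1n.
- move=> i t phi aphi; apply: contra_not; rewrite tnth_map -(autX aphi) => ti.
  by apply: (bij_inj aphi.1); rewrite ti (aut1 aphi).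
exists N => x; have {}PN (y : G) : y ^+ (5 ^ N) <> 1 -> y ^+ (5 ^ N.+1) <> 1.
  by move=> yN; have := PN [tuple y]; rewrite (tnth_nth 1); exact.
apply: contrapT => xN; have [k [_ xk _]] := fiveG x.
have {xk} : x ^+ (5 ^ (N + k)) = 1 by rewrite expnD mulnC expgnA xk expg1n.
elim: k x xN => [|k IHk] x xN; first by rewrite addn0.
rewrite addnS expnS expgnA; apply: IHk.
by have := PN x xN; rewrite expnS expgnA.
Qed.

(** As [g] is a coordinate of the 5-tuple, one stationary index [n] serves all normal closures, and
    [section_chain] would contradict it. *)
Lemma q_nilpotent : exists N, forall (g : G) (xs : seq G), size xs = N ->
  (\prod_(x <- xs) q (@qrho G (frat_section g)) x = 0)%R.
Proof.
pose P i (t : 5.-tuple G) := chain_from (frat_section (tnth t 0%R)) i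
  (tnth t 1%R) (tnth t (inord 2)) (tnth t (inord 3)) (tnth t (inord 4)).
have [||n Pn] := @omega_stationary G omega_cat 5 P.
- move=> i t [f [f0 tf bf]]; exists f; split=> // j j_i.
    exact: tf (leqW j_i).
  exact: bf (leqW j_i).
- move=> i t phi aphi; rewrite /P !tnth_map; exact: aut_chain.
exists ((2 * n.+1).+1)%N => g xs size_xs; apply: contrapT => /eqP xs0.
have [u [v [al [be [ch nch]]]]] := section_chain engel (frat_char5 g)
  (ncl_class2 omega_cat engel fiveG) size_xs xs0.
apply: nch; have := Pn [tuple g; u; v; al; be].
by rewrite /P !(tnth_nth 1) /= !inordK //=; exact.
Qed.

Lemma frat_nilpotent : exists N, forall (g u : G) (xs : seq G),
  normal_closure g u -> size xs = N -> ncl_frat g (comms u xs).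
Proof.
have [N qN] := q_nilpotent; exists (3 * N)%N => g u xs gu size_xs.
exact: (section_nilpotent engel (frat_char5 g) (ncl_class2 omega_cat engel fiveG)
  (qN g)) gu size_xs.
Qed.

Lemma comms_cat (u : G) xs ys : comms u (xs ++ ys) = comms (comms u xs) ys.
Proof. exact: foldl_cat. Qed.

Lemma ncl_comms (g u : G) xs : normal_closure g u -> normal_closure g (comms u xs).
Proof. exact: (@top_comms G (ab_section g)). Qed.

Lemma endo_mulrn (M : zmodType) (h : endo M) (m : M) n :
  (sval h (m *+ n) = sval h m *+ n)%R.
Proof. by elim: n => [|n IHn]; rewrite ?endo_0 // !mulrS endoD IHn. Qed.

(** On V/V' each block of [N] commutators gains a factor 5 by [frat_nilpotent]; after [k] blocks the
    exponent is reached. *)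
Lemma der_nilpotent : exists N, forall (g u : G) (xs : seq G),
  normal_closure g u -> size xs = N -> ncl_der g (comms u xs).
Proof.
have [N fN] := frat_nilpotent; have [k exp_k] := exponent_bounded.
exists (N * k)%N => g u xs gu size_xs; pose s := ab_section g.
have [m Em] : exists m, (cls s (comms u xs) = m *+ (5 ^ k))%R.
  elim: {exp_k} k xs size_xs => [|k IHk] xs.
    by rewrite muln0 => /size0nil ->; exists (cls s u).
  rewrite mulnS addnC => size_xs; rewrite -(cat_take_drop (N * k) xs) comms_cat.
  have [|m Em] := IHk (take (N * k) xs).
    by rewrite size_takel // size_xs leq_addr.
  have size_d : size (drop (N * k) xs) = N by rewrite size_drop size_xs addKn.
  move: (drop _ _) (comms u _) (ncl_comms (take (N * k) xs) gu) Em size_d.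
  move=> ys w gw Em size_ys; rewrite (@cls_comms _ s) // Em endo_mulrn.
  elim/quo_ind: m {Em} => z sz; rewrite -cls_comms //.
  have [m ->] := frat_cls5 (fN g z ys sz size_ys).
  by exists m; rewrite -mulrnA expnS.
apply/(@cls0 _ s); first exact: ncl_comms.
elim/quo_ind: m Em => z sz ->; rewrite -clsX // exp_k; exact: cls1.
Qed.

Let class2 := ncl_class2 omega_cat engel fiveG.

Lemma der_commute (g x w : G) : ncl_der g x -> normal_closure g w -> commute x w.
Proof.
move=> Dx gw; apply: (smallest_sub (X :=
  [set x | commute x w])) Dx => [|_ [u gu [z gz <-]]].
  split=> [|y z /= Cy Cz]; first exact/commute_sym/commute1.
  exact/commute_sym/commuteM/commuteV/commute_sym/Cz/commute_sym.
by apply/commgP/eqP; exact: (class2 gu gz gw).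
Qed.

Lemma comms1 xs : comms 1 xs = 1 :> G.
Proof. by elim: xs => //= x xs IHxs; rewrite comm1g. Qed.

Lemma der_comm (g x y : G) : ncl_der g x -> ncl_der g [~ x, y].
Proof.
move=> Dx; have sD : is_subgroup (ncl_der g) by exact: subgroup_smallest.
by rewrite commgEl; apply: subgroupM sD (subgroupV sD Dx) (ncl_derJ y Dx).
Qed.

Lemma comms_derM (g x y : G) xs : ncl_der g x -> ncl_der g y ->
  comms (x * y) xs = comms x xs * comms y xs.
Proof.
elim: xs x y => [//|z xs IHxs] x y Dx Dy /=.
rewrite -IHxs; try exact: der_comm.
congr (comms _ _); rewrite commMg.
suff -> : [~ x, z] ^ y = [~ x, z] by [].
by apply/conjg_fixP/commgP; exact: der_commute (der_comm z Dx) (ncl_der_sub Dy).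
Qed.

(** A Leibniz rule: as V' is central in V, [[~ u, w, x]] is the product of [[~ u, w']], [[~ u', w]]
    and [[~ u', w']] with [u' = [~ u, x]] and [w' = [~ w, x]], and each replacement lowers [i] or
    [j]. *)
Lemma comm_nilpotent (g u w : G) i j : normal_closure g u -> normal_closure g w ->
    (forall xs : seq G, size xs = i -> ncl_der g (comms u xs)) ->
    (forall xs : seq G, size xs = j -> ncl_der g (comms w xs)) ->
  forall xs : seq G, size xs = (i + j)%N -> comms [~ u, w] xs = 1.
Proof.
have sD : is_subgroup (ncl_der g) by exact: subgroup_smallest.
have up k (v : G) : (forall xs : seq G, size xs = k -> ncl_der g (comms v xs)) ->
    forall xs : seq G, size xs = k.+1 -> ncl_der g (comms v xs).
  move=> Sv xs; case/lastP: xs => // xs x; rewrite size_rcons => -[size_xs].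
  by rewrite -cats1 comms_cat /=; apply: der_comm; exact: Sv.
have down k (v y : G) : (forall xs : seq G, size xs = k.+1 -> ncl_der g (comms v xs)) ->
    forall xs : seq G, size xs = k -> ncl_der g (comms [~ v, y] xs).
  by move=> Sv xs size_xs; have := Sv (y :: xs); rewrite /= size_xs; exact.
move=> gu gw Su Sw xs;
  elim: xs i j u w gu gw Su Sw => [|x xs IHxs] i j u w gu gw Su Sw.
  case: i Su => // Su _; have /= Du := Su [::] erefl.
  by apply/eqP/commgP; exact: der_commute Du gw.
case: i Su => [Su _|i Su].
  have /= Du := Su [::] erefl.
  by have /commgP/eqP -> := der_commute Du gw; exact: (comms1 (x :: xs)).
case: j Sw => [Sw _|j Sw].
  have /= Dw := Sw [::] erefl.
  by have /commute_sym/commgP/eqP -> := der_commute Dw gu;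
    exact: (comms1 (x :: xs)).
rewrite addSn => -[size_xs] /=.
set u' := [~ u, x]; set w' := [~ w, x].
have gu' : normal_closure g u' by exact: ncl_comm.
have gw' : normal_closure g w' by exact: ncl_comm.
have D a b : normal_closure g a -> normal_closure g b -> ncl_der g [~ a, b].
  exact: ncl_der_comm.
have -> : [~ [~ u, w], x] = [~ u, w'] * ([~ u', w] * [~ u', w']).
  have fixJ a b v : normal_closure g a -> normal_closure g b ->
      normal_closure g v -> [~ a, b] ^ v = [~ a, b].
    by move=> ga gb gv; apply/conjg_fixP/eqP; exact: (class2 ga gb gv).
  have Cm a b v : normal_closure g a -> normal_closure g b ->
      normal_closure g v -> [~ a, b] * v = v * [~ a, b].
    by move=> ga gb gv; exact: der_commute (D a b ga gb) gv.
  rewrite commgEl conjRg (conjg_comm u x) (conjg_comm w x) -/u' -/w'.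
  have guw' : normal_closure g [~ u, w'] by exact: ncl_comm.
  have gu'w' : normal_closure g [~ u', w'] by exact: ncl_comm.
  rewrite (commMg u u') !(commgM _ w w') (conjMg [~ u, w'] ([~ u, w] ^ w') u') !fixJ //.
  have C1 := Cm u w _ gu gw guw'; have C2 := Cm u' w _ gu' gw gu'w'.
  move: [~ u, w] [~ u, w'] [~ u', w] [~ u', w'] C1 C2 => p a b e C1 C2.
  by rewrite -C1 -!mulgA mulKg C2.
have E1 : comms [~ u, w'] xs = 1.
  by apply: (IHxs i.+1 j) => //; [exact: down | rewrite addSnnS].
have E2 : comms [~ u', w] xs = 1.
  by apply: (IHxs i j.+1) => //; exact: down.
have E3 : comms [~ u', w'] xs = 1.
  apply: (IHxs i j.+1) => //; [exact: down|].
  by apply: up; exact: down.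
have [D1 D2 D3] := And3 (D _ _ gu gw') (D _ _ gu' gw) (D _ _ gu' gw').
by rewrite (comms_derM _ D1 (subgroupM sD D2 D3)) (comms_derM _ D2 D3) E1 E2 E3 !mulg1.
Qed.

(** The first [N] commutators bring [g] into V'; the other [2 N] kill the generators of V', on which
    [comms] is multiplicative. *)
Lemma comms_trivial : exists N, forall (g : G) (xs : seq G),
  size xs = N -> comms g xs = 1.
Proof.
have [N dN] := der_nilpotent; exists (N + (N + N))%N => g xs size_xs.
rewrite -(cat_take_drop N xs) comms_cat.
have size_t : size (take N xs) = N by rewrite size_takel // size_xs leq_addr.
have : size (drop N xs) = (N + N)%N by rewrite size_drop size_xs addKn.
have := dN g g _ (@ncl_id G g) size_t.
move: (comms g _) (drop N xs) => h ys Dh size_ys.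
suff [] : ncl_der g h /\ comms h ys = 1 by [].
have sD : is_subgroup (ncl_der g) by exact: subgroup_smallest.
apply: (smallest_sub (X := [set h | ncl_der g h /\ comms h ys = 1])) Dh.
  split=> [|x y [Dx Ex] [Dy Ey]]; first by split;
    [exact: subgroup1 | exact: comms1].
  have DV : ncl_der g y^-1 by exact: subgroupV sD Dy.
  split; first exact: sD.2.
  rewrite (comms_derM _ Dx DV) Ex mul1g.
  by rewrite -[LHS]mul1g -{1}Ey -(comms_derM _ Dy DV) mulgV comms1.
move=> _ [u gu [w gw <-]]; split; first exact: ncl_der_comm.
by apply: (comm_nilpotent (g := g) (i := N) (j := N)) => // zs; exact: dN.
Qed.

Lemma lower_central_sub n (K : nat) :
    (forall (g : G) (xs : seq G), size xs = (n + K)%N -> comms g xs = 1) ->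
  forall h, lower_central G n h -> forall xs : seq G, size xs = K -> comms h xs = 1.
Proof.
(* [Z k] is the [k]-th term of the upper central series; the induction on [n] trades one step of the
   lower series for one of the upper. *)
pose Z k (h : G) := forall xs : seq G, size xs = k -> comms h xs = 1.
have commsJ (h y : G) xs : comms (h ^ y) xs = (comms h [seq x ^ y^-1 | x <- xs]) ^ y.
  elim: xs h => [//|x xs IHxs] h /=.
  by rewrite -IHxs conjRg conjgKV.
have ZJ k h y : Z k h -> Z k (h ^ y).
  by move=> Zh xs size_xs; rewrite commsJ Zh ?conj1g // size_map.
have Zsub k : is_subgroup (Z k).
  elim: k => [|k [Z1 ZB]].
    split=> [|x y Zx Zy] xs /size0nil -> //=.
    by have /= -> := Zx [::] erefl; have /= -> := Zy [::] erefl; rewrite divgg.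
  have ZS h : (forall x, Z k [~ h, x]) -> Z k.+1 h.
    by move=> Zh [//|x xs] [size_xs]; exact: Zh.
  have ZC h x : Z k.+1 h -> Z k [~ h, x].
    by move=> Zh xs size_xs; apply: (Zh (x :: xs)); rewrite /= size_xs.
  split; first by apply: ZS => x; rewrite comm1g.
  move=> x y Zx Zy; apply: ZS => z; rewrite commMg.
  have -> : [~ y^-1, z] = ([~ y, z]^-1) ^ y^-1.
    by have := commMg y y^-1 z; rewrite mulgV comm1g conjVg => /esym/mulg1_eq.
  apply: subgroupM (conj Z1 ZB) (ZJ _ _ _ (ZC _ _ Zx)) (ZJ _ _ _ _).
  by apply: subgroupV (conj Z1 ZB) (ZC _ _ Zy).
elim: n K => [|n IHn] K triv h; first by move=> _ xs size_xs; exact: triv.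
apply: (smallest_sub (X := Z K)) => // _ [x Lx [y _ <-]] xs size_xs.
by apply: (IHn K.+1 _ x Lx (y :: xs)); rewrite /= ?size_xs // -addSnnS.
Qed.

Lemma three_engel_nilpotent : is_nilpotent G.
Proof.
have [N triv] := comms_trivial; exists N.
apply/seteqP; split=> [h Lh|_ ->] /=.
  (* With [K = 0] the list is empty and [comms h [::]] is [h]. *)
  by apply: (@lower_central_sub N 0 _ h Lh [::]); rewrite ?addn0.
by case: {triv} N => [//|n]; exact: subgroup1 (subgroup_smallest _).
Qed.

End Nilpotency.

Theorem corollary3p16 (G : groupType)
    (omega_cat : omega_categorical G)
    (engel : three_engel G)
    (five_group : is_pgroup 5 G) :
  is_nilpotent G.
Proof. exact: three_engel_nilpotent. Qed.
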